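(* Let $F$ be a field of characteristic zero and let $t\in\mathbb{Z}_{\ge 0}$, regarded as an element of $F$. Then there exists a nonzero trace on the ideal of negligible objects in Deligne's category $\underline{\operatorname{Rep}}(S_t)$.
   Context: Deligne's category. For $a,b\ge 0$, $P_{a,b}$ is the set of set partitions (partition diagrams) of $\{1,\dots,a,1',\dots,b'\}$ (unprimed = top, primed = bottom), and $FP_{a,b}(t)$ is the $F$-vector space with basis $P_{a,b}$. For $\pi\in P_{a,b}$, $\mu\in P_{b,c}$, the composite $\mu\pi$ is obtained by stacking $\pi$ on top of $\mu$, identifying bottom vertices of $\pi$ with top vertices of $\mu$, taking the induced partition on the outer vertices, and multiplying by $t^{\ell}$, where $\ell$ is the number of connected components consisting only of middle vertices. $\underline{\operatorname{Rep}}_0(S_t)$ has objects $[n]$, $n\in\mathbb{Z}_{\ge0}$, with $\operatorname{Hom}([a],[b])=FP_{a,b}(t)$; $[a]\otimes[b]=[a+b]$, with horizontal juxtaposition of diagrams as tensor product of morphisms; unit $[0]$; symmetric braiding $[a]\otimes[b]\to[b]\otimes[a]$ given by the diagram with parts $\{i,(b+i)'\}$ $(1\le i\le a)$ and $\{a+j,j'\}$ $(1\le j\le b)$; $[n]^*=[n]$ with evaluation the diagram with parts $\{i,n+i\}$ and coevaluation the diagram with parts $\{i',(n+i)'\}$; trivial twists. $\underline{\operatorname{Rep}}(S_t)$ is the Karoubian envelope of the additive envelope of $\underline{\operatorname{Rep}}_0(S_t)$; it is an $F$-linear ribbon category with $\operatorname{End}(\mathbf 1)=F$. Ideals and traces in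 a ribbon category $\mathcal C$ with ground field $K=\operatorname{End}(\mathbf 1)$. An ideal is a full subcategory $\mathcal I$ such that (1) if $V\in\mathcal I$ and $W\in\mathcal C$ then $V\otimes W\in\mathcal I$; (2) if $V\in\mathcal I$, $W\in\mathcal C$ and there are $f:W\to V$, $g:V\to W$ with $gf=\operatorname{Id}_W$, then $W\in\mathcal I$. With braiding $c$ and twist $\theta$, set $\operatorname{ev}'_W=\operatorname{ev}_Wc_{W,W^*}(\theta_W\otimes\operatorname{Id}_{W^*})$, and for $f\in\operatorname{End}(V\otimes W)$ set $\operatorname{tr}_R(f)=(\operatorname{Id}_V\otimes\operatorname{ev}'_W)(f\otimes\operatorname{Id}_{W^*})(\operatorname{Id}_V\otimes\operatorname{coev}_W)\in\operatorname{End}(V)$. A trace on $\mathcal I$ is a family of $K$-linear maps $\mathsf t_V:\operatorname{End}(V)\to K$, one for each object $V$ of $\mathcal I$, such that (1) for $U\in\mathcal I$, $W\in\mathcal C$ and $f\in\operatorname{End}(U\otimes W)$, $\mathsf t_{U\otimes W}(f)=\mathsf t_U(\operatorname{tr}_R(f))$; (2) for $U,V\in\mathcal I$, $f:V\to U$, $g:U\to V$, $\mathsf t_V(gf)=\mathsf t_U(fg)$. It is nonzero if some $\mathsf t_V$ is nonzero. Negligible objects. The categorical trace of $f\in\operatorname{End}(V)$ is $\operatorname{tr}_{\mathcal C}(f)=\operatorname{ev}'_V(f\otimes \operatorname{Id}_{V^*})\operatorname{coev}_V\in K$. A morphism $g:X\to Y$ is negligible if $\operatorname{tr}_{\mathcal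 C}(gh)=0$ for all $h:Y\to X$. An object $V$ is negligible if $\operatorname{Id}_V$ is a negligible morphism; the full subcategory of negligible objects is an ideal. *)

(* Defs.v *)
From HB Require Import structures.
From mathcomp Require Import all_boot all_algebra.

Set Implicit Arguments.
Unset Strict Implicit.
Unset Printing Implicit Defensive.

Import GRing.Theory.
Local Open Scope ring_scope.

(** * Partition diagrams *)

(* [inl i] is the top vertex i, [inr j] the bottom vertex j'. *)
Definition diagram (a b : nat) :=
  {P : {set {set 'I_a + 'I_b}} | partition P [set: 'I_a + 'I_b]}.

Definition block a b (p : diagram a b) (v : 'I_a + 'I_b) : {set 'I_a + 'I_b} :=
  pblock (val p) v.

(* The diagram whose parts are the nonempty fibres of [f]. *)
Definition fibres a b (T : eqType) (f : 'I_a + 'I_b -> T) : diagram a b :=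
  exist _ (preim_partition f [set: 'I_a + 'I_b])
    (preim_partitionP f [set: 'I_a + 'I_b]).

Section Stack.
Variables a b c : nat.

(* Vertices of the stacked diagram: top, middle, bottom. *)
Definition svertex := ('I_a + 'I_b + 'I_c)%type.

Definition upper (v : 'I_a + 'I_b) : svertex := inl v.
Definition middle (j : 'I_b) : svertex := inl (inr j).
Definition lower (v : 'I_b + 'I_c) : svertex :=
  match v with inl j => inl (inr j) | inr k => inr k end.
Definition outer (v : 'I_a + 'I_c) : svertex :=
  match v with inl i => inl (inl i) | inr k => inr k end.

Variables (q : diagram b c) (p : diagram a b).

Definition adjacent : rel svertex := [rel u v |
  [exists B in val p, (u \in upper @: B) && (v \in upper @: B)] ||
  [exists B in val q, (u \in lower @: B) && (v \in lower @: B)]].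

Definition component (u : svertex) : {set svertex} :=
  [set v | connect adjacent u v].

Definition stack : diagram a c := fibres (fun v => component (outer v)).

Definition loops : nat :=
  #|[set C in [set component u | u : svertex] | C \subset [set middle j | j : 'I_b]]|.

End Stack.

Definition juxtapose a b c d (p : diagram a b) (q : diagram c d) :
    diagram (a + c) (b + d) :=
  fibres (fun v : 'I_(a + c) + 'I_(b + d) =>
    match v with
    | inl k => match split k with
               | inl i => inl (block p (inl i)) | inr i => inr (block q (inl i))
               end
    | inr k => match split k with
               | inl j => inl (block p (inr j)) | inr j => inr (block q (inr j))
               end
    end).

Definition flip a b (p : diagram a b) : diagram b a :=
  fibres (fun v : 'I_b + 'I_a =>
    match v with inl j => block p (inr j) | inr i => block p (inl i) end).

(* A top vertex k is labelled [f k], a bottom vertex k' is labelled k; parts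
   are the sets of vertices with a common label.  The numbers of vertices are
   left free so that no transport along equations between naturals is needed:
   the definitions below have their intended meaning when m is respectively
   n, b + a, and when n = a + a. *)
Definition labelled n m (f : nat -> nat) : diagram n m :=
  fibres (fun v : 'I_n + 'I_m =>
    match v with inl k => f k | inr k => nat_of_ord k end).

Definition strands n m : diagram n m := labelled n m id.

Definition crossing a b m : diagram (a + b) m :=
  labelled (a + b) m (fun k => if k < a then b + k else k - a)%N.

Definition cap a n : diagram n 0 := labelled n 0 (fun k => k %% a)%N.

Definition cup a n : diagram 0 n := flip (cap a n).

(* A diagram is determined by the vertex colourings that are constant on its
   parts, and [count_stack] expresses [stack] and [loops] by counting such
   colourings of the middle vertices.  The laws of composition follow. *)

Section Colourings.
Variable K : finType.

Definition glue a b (x : 'I_a -> K) (y : 'I_b -> K) (v : 'I_a + 'I_b) : K :=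
  match v with inl i => x i | inr j => y j end.

Definition compatible a b (p : diagram a b) (x : 'I_a -> K) (y : 'I_b -> K) : bool :=
  [forall u, forall v, (block p u == block p v) ==> (glue x y u == glue x y v)].

Lemma compatibleP a b (p : diagram a b) x y :
  reflect (forall u v, block p u = block p v -> glue x y u = glue x y v)
          (compatible p x y).
Proof.
apply: (iffP forallP) => [h u v e | h u].
  by move/forallP: (h u) => /(_ v); rewrite e eqxx => /eqP.
by apply/forallP => v; apply/implyP => /eqP e; apply/eqP/h.
Qed.

End Colourings.

Lemma block_fibres a b (T : eqType) (f : 'I_a + 'I_b -> T) u v :
  (block (fibres f) u = block (fibres f) v) <-> f u = f v.
Proof.
have eqR : {in [set: 'I_a + 'I_b] & &, equivalence_rel (fun x y => f x == f y)}.
  by split=> // /eqP ->.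
have tI : trivIset (val (fibres f)).
  by have /and3P[] := valP (fibres f).
have cov w : w \in cover (val (fibres f)).
  by have /and3P[/eqP -> _ _] := valP (fibres f); rewrite inE.
split=> [e|e].
  have : v \in pblock (val (fibres f)) u by rewrite /block in e; rewrite e mem_pblock.
  by rewrite (pblock_equivalence_partition eqR) ?inE // => /eqP.
apply/eqP; rewrite /block eq_pblock // (pblock_equivalence_partition eqR) ?inE //.
by rewrite e.
Qed.

Lemma block_eq a b (p : diagram a b) u v :
  (v \in block p u) = (block p u == block p v).
Proof.
have /and3P[/eqP cov tI _] := valP p.
by rewrite /block eq_pblock // cov inE.
Qed.

Lemma mem_blocks a b (p : diagram a b) u : block p u \in val p.
Proof.
by have /and3P[/eqP cov _ _] := valP p; rewrite pblock_mem // cov inE.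
Qed.

Lemma blockE a b (p : diagram a b) B u :
  B \in val p -> u \in B -> block p u = B.
Proof.
by have /and3P[_ tI _] := valP p => BP uB; apply: def_pblock.
Qed.

Lemma diagram_ext a b (p q : diagram a b) :
  (forall u v, block p u = block p v <-> block q u = block q v) -> p = q.
Proof.
move=> h; apply: val_inj => /=.
have e w : block p w = block q w.
  apply/setP => v; rewrite !block_eq.
  by apply/eqP/eqP => /h.
suff sub (p' q' : diagram a b) : block p' =1 block q' -> val p' \subset val q'.
  by apply/eqP; rewrite eqEsubset !sub // => w; rewrite e.
move=> e'; apply/subsetP => B BP.
have /and3P[_ _ n0] := valP p'.
have /set0Pn[u uB] : B != set0 by apply: contraNneq n0 => <-.
by rewrite -(blockE BP uB) e' mem_blocks.
Qed.

Lemma compatible_fibres (K : finType) a b (T : eqType) (f : 'I_a + 'I_b -> T)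
    (x : 'I_a -> K) y :
  reflect (forall u v, f u = f v -> glue x y u = glue x y v)
          (compatible (fibres f) x y).
Proof.
apply: (iffP (compatibleP _ _ _)) => h u v e; first by apply/h/block_fibres.
by apply: h; apply/block_fibres.
Qed.

Lemma compatible_cst (K : finType) (k : K) a b (p : diagram a b) :
  compatible p (fun=> k) (fun=> k).
Proof. by apply/compatibleP => -[] ? [] ?. Qed.

Lemma diagram_match a b (p p' : diagram a b) l l' :
  (forall (K : finType) (x : 'I_a -> K) (y : 'I_b -> K),
     (#|K| ^ l * compatible p x y = #|K| ^ l' * compatible p' x y)%N) ->
  p = p' /\ l = l'.
Proof.
pose K : finType := option {set 'I_a + 'I_b} => h.
have K2 : (1 < #|K|)%N.
  by rewrite card_option ltnS; apply/card_gt0P; exists set0.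
have el : l = l'.
  have := h K (fun=> None) (fun=> None).
  by rewrite !compatible_cst !muln1 => /(expnI K2).
split=> //; subst l'.
have c (x : 'I_a -> K) y : compatible p x y = compatible p' x y.
  have /eqP := h K x y; rewrite eqn_pmul2l ?expn_gt0 ?(ltnW K2) //.
  by case: compatible; case: compatible.
have glueb (q : diagram a b) u :
    glue (fun i => Some (block q (inl i))) (fun j => Some (block q (inr j))) u
    = Some (block q u) by case: u.
have cs q : @compatible K _ _ q (fun i => Some (block q (inl i)))
                (fun j => Some (block q (inr j))).
  by apply/compatibleP => u v; rewrite !glueb => ->.
apply: diagram_ext => u v; split=> e.
  by have := cs p'; rewrite -c => /compatibleP/(_ _ _ e); rewrite !glueb => -[].
by have := cs p; rewrite c => /compatibleP/(_ _ _ e); rewrite !glueb => -[].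
Qed.

Section StackColourings.
Variables (K : finType) (a b c : nat) (q : diagram b c) (p : diagram a b).
Let V := svertex a b c.
Let comp := @component a b c q p.

Lemma adjacent_sym : symmetric (adjacent q p).
Proof.
by move=> u v; rewrite /adjacent /=; congr orb; apply: eq_existsb => B;
  rewrite [(u \in _) && _]andbC.
Qed.

Lemma adjacent_csym : connect_sym (adjacent q p).
Proof. exact/sym_connect_sym/adjacent_sym. Qed.

Lemma componentP u v : (comp u = comp v) <-> connect (adjacent q p) u v.
Proof.
split=> [e|e].
  have : v \in comp v by rewrite inE connect0.
  by rewrite -e inE.
apply/setP => w; rewrite !inE.
exact: (same_connect adjacent_csym e).
Qed.

Lemma component_id u : u \in comp u.
Proof. by rewrite inE. Qed.

Lemma component_mem u v : v \in comp u -> comp u = comp v.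
Proof. by rewrite inE => /componentP. Qed.

Lemma comp_upper u v : block p u = block p v -> comp (upper c u) = comp (upper c v).
Proof.
move=> e; apply/componentP/connect1; apply/orP; left.
apply/existsP; exists (block p u); rewrite mem_blocks.
by rewrite !imset_f // block_eq ?e.
Qed.

Lemma comp_lower u v : block q u = block q v -> comp (lower a u) = comp (lower a v).
Proof.
move=> e; apply/componentP/connect1; apply/orP; right.
apply/existsP; exists (block q u); rewrite mem_blocks.
by rewrite !imset_f // block_eq ?e.
Qed.

Lemma comp_cst (T : Type) (h : V -> T) :
  (forall u v, block p u = block p v -> h (upper c u) = h (upper c v)) ->
  (forall u v, block q u = block q v -> h (lower a u) = h (lower a v)) ->
  forall u v, comp u = comp v -> h u = h v.
Proof.
move=> hp hq u v /componentP /connectP[s].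
elim: s u => [|w s IH] u /= => [_ -> // | /andP[uw ws] e].
rewrite -(IH w ws e); case/orP: uw => /existsP[B /and3P[BP]];
  move=> /imsetP[u' uB ->] /imsetP[w' wB ->]; [apply: hp | apply: hq];
  by rewrite (blockE BP uB) (blockE BP wB).
Qed.

Let inner := [set C in [set comp u | u : V] | C \subset [set middle a c j | j : 'I_b]].

Let ofouter (C : {set svertex a b c}) := [pick v : 'I_a + 'I_c | outer b v \in C].

Lemma inner_outer u : (comp u \in inner) = (ofouter (comp u) == None).
Proof.
rewrite inE imset_f //= /ofouter; apply/idP/idP.
  case: pickP => // v vC /subsetP/(_ _ vC)/imsetP[j _].
  by case: v {vC}.
case: pickP => // h _; apply/subsetP => -[[i|j]|k] vC.
- by have := h (inl i); rewrite vC.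
- exact: imset_f.
- by have := h (inr k); rewrite vC.
Qed.

Lemma count_stack (x : 'I_a -> K) (y : 'I_c -> K) :
  (\sum_(m : {ffun 'I_b -> K}) (compatible p x m && compatible q m y)
   = #|K| ^ loops q p * compatible (stack q p) x y)%N.
Proof.
pose S := [pred m : {ffun 'I_b -> K} | compatible p x m && compatible q m y].
transitivity #|S|.
  by rewrite -sum1_card [RHS]big_mkcond; apply: eq_bigr => m _; rewrite inE; case: andb.
pose tot (m : 'I_b -> K) (v : V) : K :=
  match v with inl (inl i) => x i | inl (inr j) => m j | inr k => y k end.
have tot_outer m v : tot m (outer b v) = glue x y v by case: v.
have tot_upper m v : tot m (upper c v) = glue x m v by case: v.
have tot_lower m v : tot m (lower a v) = glue m y v by case: v.
have totS (m : {ffun 'I_b -> K}) : reflect (forall u v, comp u = comp v -> tot m u = tot m v) (m \in S).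
  apply: (iffP andP) => [[/compatibleP hp /compatibleP hq]|h].
    by apply: comp_cst => u v; rewrite ?tot_upper ?tot_lower; [apply: hp|apply: hq].
  split; apply/compatibleP => u v e.
    by rewrite -!tot_upper; apply/h/comp_upper.
  by rewrite -!tot_lower; apply/h/comp_lower.
have [st|st] := boolP (compatible (stack q p) x y); last first.
  rewrite muln0; apply: eq_card0 => m; apply/negP => /totS h.
  case/negP: st; apply/compatible_fibres => u v e.
  by rewrite -!(tot_outer m); apply: h.
rewrite muln1; move/compatible_fibres: st => st.
pose D : finType := {C : {set V} | C \in inner}.
pose mkD C (h : C \in inner) : D := exist (fun C => C \in inner) C h.
have -> : loops q p = #|{: D}| by rewrite card_sig; apply: eq_card => C.
have inV (d : D) : {j | comp (middle a c j) = val d}.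
  case: (pickP (fun j => comp (middle a c j) == val d)) => [j /eqP ej|no].
    by exists j.
  exfalso; have := valP d; rewrite inE => /andP[/imsetP[u _ eC] /subsetP sC].
  have /imsetP[j _ ej] : u \in [set middle a c j | j : 'I_b].
    by apply: sC; rewrite eC component_id.
  by have := no j; rewrite -ej eC eqxx.
have ex (g : {ffun D -> K}) j : {k : K |
    match ofouter (comp (middle a c j)) with
    | Some v => k = glue x y v
    | None => forall d : D, val d = comp (middle a c j) -> k = g d
    end}.
  case E: ofouter => [v|]; first by exists (glue x y v).
  have Ci : comp (middle a c j) \in inner by rewrite inner_outer E.
  exists (g (mkD _ Ci)) => d e; congr (g _); exact/val_inj.
pose psi g : {ffun 'I_b -> K} := [ffun j => sval (ex g j)].
have psi_some g j v : ofouter (comp (middle a c j)) = Some v -> psi g j = glue x y v.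
  by move=> e; rewrite ffunE; case: (ex g j) => k /=; rewrite e.
have psi_none g j d : val d = comp (middle a c j) -> psi g j = g d.
  move=> e; rewrite ffunE; case: (ex g j) => k /=; case E: ofouter => [v|]; last exact.
  by have := valP d; rewrite e inner_outer E.
have ofouterP C v : ofouter C = Some v -> outer b v \in C.
  by rewrite /ofouter; case: pickP => // w wC [<-].
have psi_inj : injective psi.
  move=> g g' e; apply/ffunP => d; case: (inV d) => j ej.
  by rewrite -(psi_none g j) // -(psi_none g' j) // e.
have -> : #|S| = #|psi @: [set: {ffun D -> K}]|; last first.
  by rewrite card_imset // cardsT card_ffun.
apply: eq_card => m; apply/totS/imsetP => [h | [g _ ->] u v e].
  exists [ffun d => m (sval (inV d))] => //; apply/ffunP => j.
  case E: (ofouter (comp (middle a c j))) => [v|].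
    rewrite (psi_some _ _ _ E) -(tot_outer m).
    apply: (h (middle a c j)); exact/component_mem/ofouterP.
  have Ci : comp (middle a c j) \in inner by rewrite inner_outer E.
  rewrite (psi_none _ j (mkD _ Ci)) // ffunE.
  case: inV => j' /= e; exact: (h (middle a c j) (middle a c j')).
have tot_some w z : ofouter (comp w) = Some z -> tot (psi g) w = glue x y z.
  case: w => [[i|j]|k] E /=; last 1 first.
  - have -> : y k = glue x y (inr k) by [].
    by apply: st; exact/component_mem/ofouterP.
  - have -> : x i = glue x y (inl i) by [].
    by apply: st; exact/component_mem/ofouterP.
  - exact: psi_some.
have tot_none w d : val d = comp w -> tot (psi g) w = g d.
  case: w => [[i|j]|k] E /=; last 1 first.
  - have := valP d; rewrite E inner_outer /ofouter.
    by case: pickP => // /(_ (inr k)); rewrite component_id.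
  - have := valP d; rewrite E inner_outer /ofouter.
    by case: pickP => // /(_ (inl i)); rewrite component_id.
  - exact: psi_none.
case E: (ofouter (comp u)) => [z|].
  by rewrite (tot_some _ _ E); rewrite e in E; rewrite (tot_some _ _ E).
have Ci : comp u \in inner by rewrite inner_outer E.
by rewrite (tot_none u (mkD _ Ci)) // (tot_none v (mkD _ Ci)).
Qed.

End StackColourings.

Section DiagramLaws.

Lemma eq_compatible (K : finType) a b (p : diagram a b) (x x' : 'I_a -> K) y y' :
  x =1 x' -> y =1 y' -> compatible p x y = compatible p x' y'.
Proof.
move=> ex ey; have e : glue x y =1 glue x' y' by case.
by apply/compatibleP/compatibleP => h u v /h; rewrite !e.
Qed.

Lemma compatible_juxtapose (K : finType) a b c d (p : diagram a b) (q : diagram c d)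
    (x : 'I_(a + c) -> K) y :
  compatible (juxtapose p q) x y =
  compatible p (x \o lshift c) (y \o lshift d) &&
  compatible q (x \o @rshift a c) (y \o @rshift b d).
Proof.
apply/compatible_fibres/andP => [h | [/compatibleP hp /compatibleP hq]].
  split; apply/compatibleP.
    pose w (v : 'I_a + 'I_b) : 'I_(a + c) + 'I_(b + d) :=
      match v with inl i => inl (lshift c i) | inr j => inr (lshift d j) end.
    move=> u v e; have := h (w u) (w v).
    have split_w t : match w t with
      | inl k => match split k with
                 | inl i => inl (block p (inl i)) | inr i => inr (block q (inl i))
                 end
      | inr k => match split k with
                 | inl j => inl (block p (inr j)) | inr j => inr (block q (inr j))
                 end
      end = inl (block p t).
      by case: t => t; rewrite /= (unsplitK (inl t)).
    rewrite !split_w e => /(_ erefl).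
    by case: u v {e} => [] ? [].
  pose w (v : 'I_c + 'I_d) : 'I_(a + c) + 'I_(b + d) :=
    match v with inl i => inl (rshift a i) | inr j => inr (rshift b j) end.
  move=> u v e; have := h (w u) (w v).
  have split_w t : match w t with
    | inl k => match split k with
               | inl i => inl (block p (inl i)) | inr i => inr (block q (inl i))
               end
    | inr k => match split k with
               | inl j => inl (block p (inr j)) | inr j => inr (block q (inr j))
               end
    end = inr (block q t).
    by case: t => t; rewrite /= (unsplitK (inr t)).
  rewrite !split_w e => /(_ erefl).
  by case: u v {e} => [] ? [].
case=> k [] l /=; rewrite -[k]splitK -[l]splitK;
  case: (split k) => i; case: (split l) => j;
  rewrite /= ?(unsplitK (inl i)) ?(unsplitK (inr i)) ?(unsplitK (inl j)) ?(unsplitK (inr j)) //;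
  by case=> /hp || case=> /hq.
Qed.

Lemma compatible_flip (K : finType) a b (p : diagram a b) (x : 'I_a -> K) y :
  compatible (flip p) y x = compatible p x y.
Proof.
pose s (v : 'I_a + 'I_b) : 'I_b + 'I_a := match v with inl i => inr i | inr j => inl j end.
apply/compatible_fibres/compatibleP => h.
  move=> u v e; have := h (s u) (s v).
  by case: u v e => [] ? [] ? /= e => /(_ e).
by case=> ? [] ? /= /h.
Qed.

Lemma compatible_strands (K : finType) n (x y : 'I_n -> K) :
  compatible (strands n n) x y = [forall i, x i == y i].
Proof.
apply/compatible_fibres/forallP => [h i | h].
  by apply/eqP; apply: (h (inl i) (inr i)).
by case=> i [] j /= /val_inj ->; rewrite // (eqP (h _)).
Qed.

Lemma stackA a b c d (p : diagram a b) (q : diagram b c) (r : diagram c d) :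
  stack r (stack q p) = stack (stack r q) p /\
  (loops r (stack q p) + loops q p = loops (stack r q) p + loops r q)%N.
Proof.
apply: diagram_match => K x y; rewrite [in LHS]addnC !expnD -!mulnA.
rewrite [RHS]mulnCA -!count_stack !big_distrr /=.
under eq_bigr => m _ do
  rewrite -mulnb mulnA -count_stack big_distrl /=.
under [RHS]eq_bigr => m _ do
  rewrite -mulnb mulnCA -count_stack big_distrr /=.
rewrite exchange_big /=; apply: eq_bigr => m _; apply: eq_bigr => n _.
by rewrite -!mulnb; case: compatible; case: compatible; case: compatible.
Qed.

Lemma stack_strandsr a b (p : diagram a b) :
  stack p (strands a a) = p /\ loops p (strands a a) = 0%N.
Proof.
apply: diagram_match => K x y; rewrite -count_stack expn0 mul1n.
rewrite (bigD1 (finfun x)) //= big1 => [|m mx].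
  rewrite addn0 compatible_strands.
  have -> : [forall i, x i == finfun x i] by apply/forallP => i; rewrite ffunE.
  by congr nat_of_bool; apply: eq_compatible => // i; rewrite ffunE.
rewrite compatible_strands; case: forallP => //= h; case/eqP: mx.
by apply/ffunP => i; rewrite ffunE (eqP (h i)).
Qed.

Lemma stack_flip a b c (p : diagram a b) (q : diagram b c) :
  stack (flip p) (flip q) = flip (stack q p) /\ loops (flip p) (flip q) = loops q p.
Proof.
apply: diagram_match => K x y; rewrite compatible_flip -!count_stack.
by apply: eq_bigr => m _; rewrite !compatible_flip andbC.
Qed.

Lemma flip_strands n : flip (strands n n) = strands n n.
Proof.
suff [] : flip (strands n n) = strands n n /\ 0%N = 0%N by [].
apply: diagram_match => K x y; rewrite compatible_flip !compatible_strands.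
by congr (_ * nat_of_bool _)%N; apply: eq_forallb => i; rewrite eq_sym.
Qed.

Lemma stack_juxtapose a b c a' b' c' (p : diagram a b) (q : diagram b c)
    (p' : diagram a' b') (q' : diagram b' c') :
  stack (juxtapose q q') (juxtapose p p') = juxtapose (stack q p) (stack q' p') /\
  loops (juxtapose q q') (juxtapose p p') = (loops q p + loops q' p')%N.
Proof.
apply: diagram_match => K x y; rewrite expnD compatible_juxtapose -mulnb mulnACA.
rewrite -!count_stack big_distrlr /=.
pose h (m : {ffun 'I_b -> K} * {ffun 'I_b' -> K}) : {ffun 'I_(b + b') -> K} :=
  [ffun k => match split k with inl i => m.1 i | inr i => m.2 i end].
pose h' (m : {ffun 'I_(b + b') -> K}) : {ffun 'I_b -> K} * {ffun 'I_b' -> K} :=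
  ([ffun i => m (lshift _ i)], [ffun i => m (rshift _ i)]).
have hl m : h m \o lshift b' =1 m.1.
  by move=> i; rewrite /= ffunE (unsplitK (inl i)).
have hr m : h m \o @rshift b b' =1 m.2.
  by move=> i; rewrite /= ffunE (unsplitK (inr i)).
rewrite (reindex h); last first.
  exists h' => [m _|m _].
    case: m (hl m) (hr m) => m1 m2 /= e1 e2.
    by rewrite /h'; congr (_, _); apply/ffunP => i; rewrite [LHS]ffunE; exact: e1 || exact: e2.
  apply/ffunP => k; rewrite ffunE -[in RHS](splitK k).
  by case: (split k) => i /=; rewrite ffunE.
rewrite pair_big /=; apply: eq_bigr => m _.
rewrite !compatible_juxtapose mulnb.
rewrite (eq_compatible _ (frefl _) (hl m)) (eq_compatible _ (frefl _) (hr m)).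
rewrite (eq_compatible q (hl m) (frefl _)) (eq_compatible q' (hr m) (frefl _)).
by rewrite andbACA.
Qed.

End DiagramLaws.

(** * The category with objects [n] and Hom([a], [b]) = F P_{a,b}(t) *)

Section Linear.
Variables (R : comNzRingType) (t : R).

Definition dhom (a b : nat) := {ffun diagram a b -> R^o}.
HB.instance Definition _ a b := GRing.Lmodule.on (dhom a b).

Lemma oscaleE (k : R) (x : R^o) : k *: x = k * x.
Proof. by []. Qed.

Definition basis a b (p : diagram a b) : dhom a b := [ffun r => (r == p)%:R].

Definition dcomp a b c (g : dhom b c) (f : dhom a b) : dhom a c :=
  \sum_p \sum_q (t ^+ loops q p * (g q * f p)) *: basis (stack q p).

Definition dtens a b a' b' (f : dhom a b) (g : dhom a' b') : dhom (a + a') (b + b') :=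
  \sum_p \sum_q (f p * g q) *: basis (juxtapose p q).

(* The dual morphism: as [n]^* = [n] with the evaluation and coevaluation below,
   it turns diagrams upside down. *)
Definition ddual a b (f : dhom a b) : dhom b a := \sum_p f p *: basis (flip p).

Lemma dhom_expand a b (f : dhom a b) : f = \sum_p f p *: basis p.
Proof.
apply/ffunP => r; rewrite sum_ffunE (bigD1 r) //= big1 => [|p pr].
  by rewrite addr0 !ffunE eqxx [RHS]mulr1.
by rewrite !ffunE eq_sym (negPf pr) [LHS]mulr0.
Qed.

Lemma dlin_ext a b (V : lmodType R) (F G : dhom a b -> V) :
  linear F -> linear G -> (forall p, F (basis p) = G (basis p)) -> F =1 G.
Proof.
move=> linF linG e f; rewrite (dhom_expand f).
have lin0 (H : dhom a b -> V) : linear H -> H 0 = 0.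
  by move=> linH; have := linH (-1) 0 0; rewrite scaler0 addr0 scaleN1r addNr.
have expand (H : dhom a b -> V) : linear H ->
    H (\sum_p f p *: basis p) = \sum_p f p *: H (basis p).
  move=> linH; elim/big_rec2: _ => [|p x y _ <-]; first exact: lin0.
  by rewrite linH.
by rewrite !expand //; apply: eq_bigr => p _; rewrite e.
Qed.

Lemma dcomp_linear_r a b c (g : dhom b c) : linear (@dcomp a b c g).
Proof.
move=> k f f'; rewrite /dcomp scaler_sumr -big_split; apply: eq_bigr => p _ /=.
rewrite scaler_sumr -big_split; apply: eq_bigr => q _ /=.
rewrite scalerA -scalerDl !ffunE; congr (_ *: _).
by rewrite !mulrDr; congr (_ + _); rewrite oscaleE [g q * _]mulrCA [LHS]mulrCA.
Qed.

Lemma dcomp_linear_l a b c (f : dhom a b) : linear (fun g : dhom b c => dcomp g f).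
Proof.
move=> k g g'; rewrite /dcomp scaler_sumr -big_split; apply: eq_bigr => p _ /=.
rewrite scaler_sumr -big_split; apply: eq_bigr => q _ /=.
rewrite scalerA -scalerDl !ffunE; congr (_ *: _).
by rewrite mulrDl !mulrDr; congr (_ + _); rewrite !oscaleE -mulrA mulrCA.
Qed.

Lemma dtens_linear_r a b a' b' (f : dhom a b) : linear (@dtens a b a' b' f).
Proof.
move=> k g g'; rewrite /dtens scaler_sumr -big_split; apply: eq_bigr => p _ /=.
rewrite scaler_sumr -big_split; apply: eq_bigr => q _ /=.
rewrite scalerA -scalerDl !ffunE; congr (_ *: _).
by rewrite !mulrDr; congr (_ + _); rewrite !oscaleE mulrCA.
Qed.

Lemma dtens_linear_l a b a' b' (g : dhom a' b') :
  linear (fun f : dhom a b => dtens f g).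
Proof.
move=> k f f'; rewrite /dtens scaler_sumr -big_split; apply: eq_bigr => p _ /=.
rewrite scaler_sumr -big_split; apply: eq_bigr => q _ /=.
rewrite scalerA -scalerDl !ffunE; congr (_ *: _).
by rewrite !mulrDl; congr (_ + _); rewrite oscaleE mulrA.
Qed.

Lemma ddual_linear a b : linear (@ddual a b).
Proof.
move=> k f f'; rewrite /ddual scaler_sumr -big_split; apply: eq_bigr => p _ /=.
by rewrite scalerA -scalerDl !ffunE.
Qed.

Lemma sum_basis a b (V : lmodType R) (p : diagram a b) (G : diagram a b -> V) :
  \sum_q basis p q *: G q = G p.
Proof.
rewrite (bigD1 p) //= big1 => [|q qp]; first by rewrite ffunE eqxx scale1r addr0.
by rewrite ffunE (negPf qp) scale0r.
Qed.

Lemma dcomp_basis a b c (q : diagram b c) (p : diagram a b) :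
  dcomp (basis q) (basis p) = t ^+ loops q p *: basis (stack q p).
Proof.
rewrite /dcomp -[RHS](sum_basis p (fun p => t ^+ loops q p *: basis (stack q p))).
apply: eq_bigr => p' _.
rewrite -(sum_basis q (fun q => t ^+ loops q p' *: basis (stack q p'))) scaler_sumr.
by apply: eq_bigr => q' _; rewrite !scalerA [basis q q' * _]mulrC [_ * t ^+ _]mulrC.
Qed.

Lemma dtens_basis a b c d (p : diagram a b) (q : diagram c d) :
  dtens (basis p) (basis q) = basis (juxtapose p q).
Proof.
rewrite /dtens -[RHS](sum_basis p (fun p => basis (juxtapose p q))).
apply: eq_bigr => p' _.
rewrite -(sum_basis q (fun q => basis (juxtapose p' q))) scaler_sumr.
by apply: eq_bigr => q' _; rewrite scalerA.
Qed.

Lemma ddual_basis a b (p : diagram a b) : ddual (basis p) = basis (flip p).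
Proof. exact: sum_basis. Qed.

Lemma dcompZr a b c k (g : dhom b c) (f : dhom a b) : dcomp g (k *: f) = k *: dcomp g f.
Proof.
have lin := @dcomp_linear_r a b c g.
have e0 : dcomp g 0 = 0 :> dhom a c.
  by have := lin (-1) 0 0; rewrite scaler0 addr0 scaleN1r addNr.
by have := lin k f 0; rewrite e0 !addr0.
Qed.

Lemma dcompZl a b c k (g : dhom b c) (f : dhom a b) : dcomp (k *: g) f = k *: dcomp g f.
Proof.
have lin := @dcomp_linear_l a b c f.
have e0 : dcomp 0 f = 0 :> dhom a c.
  by have := lin (-1) 0 0; rewrite scaler0 addr0 scaleN1r addNr.
by have := lin k g 0; rewrite e0 !addr0.
Qed.

Lemma dtensZ a b a' b' k l (f : dhom a b) (g : dhom a' b') :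
  dtens (k *: f) (l *: g) = (k * l) *: dtens f g.
Proof.
rewrite /dtens scaler_sumr; apply: eq_bigr => p _.
rewrite scaler_sumr; apply: eq_bigr => q _.
by rewrite scalerA !ffunE; congr (_ *: _); rewrite !oscaleE mulrACA.
Qed.

Lemma ddualZ a b k (f : dhom a b) : ddual (k *: f) = k *: ddual f.
Proof.
by rewrite /ddual scaler_sumr; apply: eq_bigr => p _; rewrite scalerA ffunE.
Qed.

Lemma dcompA a b c d (h : dhom c d) (g : dhom b c) (f : dhom a b) :
  dcomp h (dcomp g f) = dcomp (dcomp h g) f.
Proof.
move: h; apply: dlin_ext; first exact: dcomp_linear_l.
  by move=> k h h'; rewrite !dcomp_linear_l.
move=> r; move: g; apply: (@dlin_ext _ _ _ (fun g => dcomp (basis r) (dcomp g f))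
    (fun g => dcomp (dcomp (basis r) g) f)).
- by move=> k g g'; rewrite dcomp_linear_l dcomp_linear_r.
- by move=> k g g'; rewrite dcomp_linear_r dcomp_linear_l.
move=> q; move: f; apply: (@dlin_ext _ _ _ (fun f => dcomp (basis r) (dcomp (basis q) f))
    (fun f => dcomp (dcomp (basis r) (basis q)) f)).
- by move=> k f f'; rewrite !dcomp_linear_r.
- exact: dcomp_linear_r.
move=> p; rewrite !dcomp_basis dcompZr dcompZl !dcomp_basis !scalerA -!exprD.
by have [-> e] := stackA p q r; rewrite addnC e addnC.
Qed.

Lemma dcomp_strandsr a b (f : dhom a b) : dcomp f (basis (strands a a)) = f.
Proof.
move: f; apply: (@dlin_ext _ _ _ (fun f => dcomp f (basis (strands a a))) id).
- exact: dcomp_linear_l.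
- by [].
by move=> p; rewrite dcomp_basis; have [-> ->] := stack_strandsr p; rewrite scale1r.
Qed.

Lemma ddual_comp a b c (g : dhom b c) (f : dhom a b) :
  ddual (dcomp g f) = dcomp (ddual f) (ddual g).
Proof.
move: g; apply: (@dlin_ext _ _ _ (fun g => ddual (dcomp g f))
   (fun g => dcomp (ddual f) (ddual g))).
- by move=> k g g'; rewrite dcomp_linear_l ddual_linear.
- by move=> k g g'; rewrite ddual_linear dcomp_linear_r.
move=> q; move: f; apply: (@dlin_ext _ _ _ (fun f => ddual (dcomp (basis q) f))
   (fun f => dcomp (ddual f) (ddual (basis q)))).
- by move=> k f f'; rewrite dcomp_linear_r ddual_linear.
- by move=> k f f'; rewrite ddual_linear dcomp_linear_l.
move=> p; rewrite dcomp_basis ddualZ !ddual_basis dcomp_basis.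
by have [-> ->] := stack_flip p q.
Qed.

Lemma dtens_comp a b c a' b' c' (g : dhom b c) (f : dhom a b)
    (g' : dhom b' c') (f' : dhom a' b') :
  dcomp (dtens g g') (dtens f f') = dtens (dcomp g f) (dcomp g' f').
Proof.
move: g; apply: (@dlin_ext _ _ _ (fun g => dcomp (dtens g g') (dtens f f'))
   (fun g => dtens (dcomp g f) (dcomp g' f'))).
- by move=> k g h; rewrite dtens_linear_l dcomp_linear_l.
- by move=> k g h; rewrite dcomp_linear_l dtens_linear_l.
move=> q; move: g'; apply: (@dlin_ext _ _ _
   (fun g' => dcomp (dtens (basis q) g') (dtens f f'))
   (fun g' => dtens (dcomp (basis q) f) (dcomp g' f'))).
- by move=> k g h; rewrite dtens_linear_r dcomp_linear_l.
- by move=> k g h; rewrite dcomp_linear_l dtens_linear_r.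
move=> q'; move: f; apply: (@dlin_ext _ _ _
   (fun f => dcomp (dtens (basis q) (basis q')) (dtens f f'))
   (fun f => dtens (dcomp (basis q) f) (dcomp (basis q') f'))).
- by move=> k g h; rewrite dtens_linear_l dcomp_linear_r.
- by move=> k g h; rewrite dcomp_linear_r dtens_linear_l.
move=> p; move: f'; apply: (@dlin_ext _ _ _
   (fun f' => dcomp (dtens (basis q) (basis q')) (dtens (basis p) f'))
   (fun f' => dtens (dcomp (basis q) (basis p)) (dcomp (basis q') f'))).
- by move=> k g h; rewrite dtens_linear_r dcomp_linear_r.
- by move=> k g h; rewrite dcomp_linear_r dtens_linear_r.
move=> p'; rewrite !dtens_basis !dcomp_basis dtensZ dtens_basis -exprD.
by have [-> ->] := stack_juxtapose p q p' q'.
Qed.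

(** * Additive envelope *)

(* The formal direct sum of the objects [[deg i]], i in a finite type. *)
Record fsum := FSum { fidx : finType; deg : fidx -> nat }.

(* Matrices with (i, j) entry in [dhom (deg i) (deg j)]: the free module on the
   disjoint union of the bases of the entries. *)
Definition fhom (A B : fsum) :=
  {ffun {ij : fidx A * fidx B & diagram (deg ij.1) (deg ij.2)} -> R^o}.
HB.instance Definition _ A B := GRing.Lmodule.on (fhom A B).

Definition entry A B (f : fhom A B) (i : fidx A) (j : fidx B) : dhom (deg i) (deg j) :=
  [ffun p => f (existT (fun ij => diagram (deg ij.1) (deg ij.2)) (i, j) p)].

Definition of_entries A B (G : forall (i : fidx A) (j : fidx B), dhom (deg i) (deg j)) :
    fhom A B :=
  [ffun u => G (tag u).1 (tag u).2 (tagged u)].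

Definition fcomp A B C (g : fhom B C) (f : fhom A B) : fhom A C :=
  of_entries (fun i k => \sum_j dcomp (entry g j k) (entry f i j)).

Definition ftens0 (A B : fsum) : fsum :=
  @FSum (fidx A * fidx B)%type (fun ij => deg ij.1 + deg ij.2)%N.

Definition ftens A A' B B' (f : fhom A A') (g : fhom B B') :
    fhom (ftens0 A B) (ftens0 A' B') :=
  of_entries (fun (i : fidx (ftens0 A B)) (j : fidx (ftens0 A' B')) =>
    dtens (entry f i.1 j.1) (entry g i.2 j.2)).

Definition fdual A B (f : fhom A B) : fhom B A :=
  of_entries (fun j i => ddual (entry f i j)).

Definition funit : fsum := @FSum unit (fun=> 0%N).

(* Identity strands between the summands i and [s i], for all i. *)
Definition relabel A B (s : fidx A -> fidx B) : fhom A B :=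
  of_entries (fun i j => (s i == j)%:R *: basis (strands (deg i) (deg j))).

Definition fid A : fhom A A := @relabel A A id.

Definition fassoc A B C : fhom (ftens0 A (ftens0 B C)) (ftens0 (ftens0 A B) C) :=
  @relabel (ftens0 A (ftens0 B C)) (ftens0 (ftens0 A B) C)
    (fun i => ((i.1, i.2.1), i.2.2)).
Definition fassocV A B C : fhom (ftens0 (ftens0 A B) C) (ftens0 A (ftens0 B C)) :=
  @relabel (ftens0 (ftens0 A B) C) (ftens0 A (ftens0 B C))
    (fun i => (i.1.1, (i.1.2, i.2))).
Definition flunit A : fhom (ftens0 funit A) A := @relabel (ftens0 funit A) A snd.
Definition flunitV A : fhom A (ftens0 funit A) := @relabel A (ftens0 funit A) (pair tt).
Definition frunit A : fhom (ftens0 A funit) A := @relabel (ftens0 A funit) A fst.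
Definition frunitV A : fhom A (ftens0 A funit) := @relabel A (ftens0 A funit) (pair^~ tt).

Definition fbraid A B : fhom (ftens0 A B) (ftens0 B A) :=
  of_entries (fun (i : fidx (ftens0 A B)) (j : fidx (ftens0 B A)) =>
    (j == (i.2, i.1))%:R *: basis (crossing (deg i.1) (deg i.2) (deg j))).

Definition fev A : fhom (ftens0 A A) funit :=
  of_entries (fun (i : fidx (ftens0 A A)) (j : fidx funit) =>
    (i.1 == i.2)%:R *: basis (cap (deg i.1) (deg i))).

Definition fcoev A : fhom funit (ftens0 A A) :=
  of_entries (fun (i : fidx funit) (j : fidx (ftens0 A A)) =>
    (j.1 == j.2)%:R *: basis (cup (deg j.1) (deg j))).

Lemma of_entriesK A B G i j : entry (@of_entries A B G) i j = G i j.
Proof. by apply/ffunP => p; rewrite !ffunE. Qed.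

Lemma entryP A B (f g : fhom A B) : (forall i j, entry f i j = entry g i j) -> f = g.
Proof.
move=> e; apply/ffunP => -[[i j] p].
by have /ffunP/(_ p) := e i j; rewrite !ffunE.
Qed.

Lemma entry_linear A B i j : linear (fun f : fhom A B => entry f i j).
Proof. by move=> k f g; apply/ffunP => p; rewrite !ffunE. Qed.

HB.instance Definition _ a b c (g : dhom b c) :=
  GRing.isLinear.Build R (dhom a b) (dhom a c) _ (@dcomp a b c g) (@dcomp_linear_r a b c g).

Lemma dcomp_sumr a b c (I : finType) (g : dhom b c) (f : I -> dhom a b) :
  dcomp g (\sum_i f i) = \sum_i dcomp g (f i).
Proof. exact: linear_sum. Qed.

Lemma dcomp_suml a b c (I : finType) (g : I -> dhom b c) (f : dhom a b) :
  dcomp (\sum_i g i) f = \sum_i dcomp (g i) f.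
Proof.
elim/big_rec2: _ => [|i x y _ <-]; first by have := dcompZl 0 (0 : dhom b c) f; rewrite !scale0r.
by have := dcomp_linear_l f 1 (g i) y; rewrite !scale1r.
Qed.

Lemma dtens_sum a b a' b' (I J : finType) (f : I -> dhom a b) (g : J -> dhom a' b') :
  dtens (\sum_i f i) (\sum_j g j) = \sum_i \sum_j dtens (f i) (g j).
Proof.
have l0 g' : dtens 0 g' = 0 :> dhom (a + a') (b + b').
  by have := @dtensZ _ _ _ _ 0 1 (0 : dhom a b) g'; rewrite mul0r !scale0r scale1r.
have r0 f' : dtens f' 0 = 0 :> dhom (a + a') (b + b').
  by have := @dtensZ _ _ _ _ 1 0 f' (0 : dhom a' b'); rewrite mulr0 !scale0r scale1r.
elim/big_rec2: _ => [|i x y _ <-]; first exact: l0.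
have := dtens_linear_l (\sum_j g j) 1 (f i) y; rewrite !scale1r => ->; congr (_ + _).
elim/big_rec2: _ => [|j u v _ <-]; first exact: r0.
by have := dtens_linear_r (f i) 1 (g j) v; rewrite !scale1r.
Qed.

Lemma ddual_sum a b (I : finType) (f : I -> dhom a b) :
  ddual (\sum_i f i) = \sum_i ddual (f i).
Proof.
elim/big_rec2: _ => [|i x y _ <-].
  by have := ddualZ 0 (0 : dhom a b); rewrite !scale0r.
by have := @ddual_linear a b 1 (f i) y; rewrite !scale1r.
Qed.

Lemma fcompA A B C D (h : fhom C D) (g : fhom B C) (f : fhom A B) :
  fcomp h (fcomp g f) = fcomp (fcomp h g) f.
Proof.
apply: entryP => i l; rewrite !of_entriesK.
under eq_bigr => k _ do rewrite of_entriesK dcomp_sumr.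
under [RHS]eq_bigr => j _ do rewrite of_entriesK dcomp_suml.
rewrite exchange_big; apply: eq_bigr => j _; apply: eq_bigr => k _.
exact: dcompA.
Qed.

Lemma fcomp_linear_r A B C (g : fhom B C) : linear (@fcomp A B C g).
Proof.
move=> k f f'; apply: entryP => i l; rewrite entry_linear !of_entriesK.
rewrite scaler_sumr -big_split; apply: eq_bigr => j _ /=.
by rewrite entry_linear dcomp_linear_r.
Qed.

Lemma fcomp_linear_l A B C (f : fhom A B) : linear (fun g : fhom B C => fcomp g f).
Proof.
move=> k g g'; apply: entryP => i l; rewrite entry_linear !of_entriesK.
rewrite scaler_sumr -big_split; apply: eq_bigr => j _ /=.
by rewrite entry_linear dcomp_linear_l.
Qed.

Lemma ftens_comp A B C A' B' C' (g : fhom B C) (f : fhom A B)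
    (g' : fhom B' C') (f' : fhom A' B') :
  fcomp (ftens g g') (ftens f f') = ftens (fcomp g f) (fcomp g' f').
Proof.
apply: entryP => i k; rewrite !of_entriesK dtens_sum pair_big /=.
by apply: eq_bigr => j _; rewrite !of_entriesK dtens_comp.
Qed.

Lemma fdual_comp A B C (g : fhom B C) (f : fhom A B) :
  fdual (fcomp g f) = fcomp (fdual f) (fdual g).
Proof.
apply: entryP => k i; rewrite !of_entriesK ddual_sum.
by apply: eq_bigr => j _; rewrite !of_entriesK ddual_comp.
Qed.

Lemma funit_idem : fcomp (fid funit) (fid funit) = fid funit.
Proof.
apply: entryP => -[] []; rewrite !of_entriesK.
rewrite (bigD1 tt) //= big1 => [|[] //]; rewrite of_entriesK addr0 eqxx scale1r.
exact: dcomp_strandsr.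
Qed.

(** * Karoubian envelope *)

Record kobj := KObj { kbase : fsum; kidem : fhom kbase kbase;
                      kidemP : fcomp kidem kidem = kidem }.

Definition kfixed X Y : {pred fhom (kbase X) (kbase Y)} :=
  fun f => fcomp (kidem Y) (fcomp f (kidem X)) == f.

Lemma kfixed_submod X Y : subsemimod_closed (@kfixed X Y).
Proof.
have linK : linear (fun f => fcomp (kidem Y) (fcomp f (kidem X))).
  by move=> k f g; rewrite fcomp_linear_l fcomp_linear_r.
have K0 : fcomp (kidem Y) (fcomp 0 (kidem X)) = 0.
  by have := linK (-1) 0 0; rewrite scaler0 addr0 scaleN1r addNr.
split; first split.
- by rewrite unfold_in /kfixed K0.
- move=> f g; rewrite !unfold_in /kfixed => /eqP ef /eqP eg.
  by have := linK 1 f g; rewrite !scale1r => ->; rewrite ef eg.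
- move=> k f; rewrite !unfold_in /kfixed => /eqP ef.
  by have := linK k f 0; rewrite K0 !addr0 => ->; rewrite ef.
Qed.

HB.instance Definition _ X Y :=
  GRing.isSubmodClosed.Build R (fhom (kbase X) (kbase Y)) (@kfixed X Y) (@kfixed_submod X Y).

(* Hom(X, Y), the submodule of all f with e_Y f e_X = f. *)
Record khom X Y := KHom { kval :> fhom (kbase X) (kbase Y); kvalP : kval \in @kfixed X Y }.

HB.instance Definition _ X Y := [isSub for @kval X Y].
HB.instance Definition _ X Y := [Choice of khom X Y by <:].
HB.instance Definition _ X Y := [SubChoice_isSubLmodule of khom X Y by <:].

Lemma kvalE X Y (f : khom X Y) : fcomp (kidem Y) (fcomp f (kidem X)) = f.
Proof. by have := kvalP f; rewrite unfold_in => /eqP. Qed.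

Lemma kvall X Y (f : khom X Y) : fcomp (kidem Y) f = f.
Proof. by rewrite -{1}kvalE fcompA kidemP kvalE. Qed.

Lemma kvalr X Y (f : khom X Y) : fcomp f (kidem X) = f.
Proof. by rewrite -{1}kvalE -!fcompA kidemP kvalE. Qed.

Lemma kproj_subproof X Y (f : fhom (kbase X) (kbase Y)) :
  fcomp (kidem Y) (fcomp f (kidem X)) \in @kfixed X Y.
Proof. by rewrite unfold_in /kfixed -!fcompA kidemP !fcompA kidemP. Qed.

Definition kproj X Y (f : fhom (kbase X) (kbase Y)) : khom X Y :=
  KHom (kproj_subproof f).

Lemma kcomp_subproof X Y Z (g : khom Y Z) (f : khom X Y) :
  fcomp g f \in @kfixed X Z.
Proof. by rewrite unfold_in /kfixed -fcompA kvalr fcompA kvall. Qed.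

Definition kcomp X Y Z (g : khom Y Z) (f : khom X Y) : khom X Z :=
  KHom (kcomp_subproof g f).

Lemma kid_subproof X : kidem X \in @kfixed X X.
Proof. by rewrite unfold_in /kfixed !kidemP. Qed.

Definition kid X : khom X X := KHom (kid_subproof X).

Lemma ktens0_subproof X Y :
  fcomp (ftens (kidem X) (kidem Y)) (ftens (kidem X) (kidem Y)) = ftens (kidem X) (kidem Y).
Proof. by rewrite ftens_comp !kidemP. Qed.

Definition ktens0 X Y : kobj := KObj (ktens0_subproof X Y).

Lemma ktens_subproof X X' Y Y' (f : khom X X') (g : khom Y Y') :
  ftens f g \in @kfixed (ktens0 X Y) (ktens0 X' Y').
Proof. by rewrite unfold_in /kfixed /= !ftens_comp !kvalE. Qed.

Definition ktens X X' Y Y' (f : khom X X') (g : khom Y Y') :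
    khom (ktens0 X Y) (ktens0 X' Y') :=
  KHom (ktens_subproof f g).

Definition kunit : kobj := KObj funit_idem.

Lemma kdual0_subproof X : fcomp (fdual (kidem X)) (fdual (kidem X)) = fdual (kidem X).
Proof. by rewrite -fdual_comp kidemP. Qed.

Definition kdual0 X : kobj := @KObj (kbase X) _ (kdual0_subproof X).

End Linear.

(** * Ideals and traces *)

(* Objects, morphisms and structure maps of a K-linear ribbon category; the
   axioms of a ribbon category play no role in the definitions below. *)
Record ribbon_data (K : comNzRingType) := RibbonData {
  Ob :> Type;
  Hom : Ob -> Ob -> lmodType K;
  compm : forall X Y Z, Hom Y Z -> Hom X Y -> Hom X Z;
  idm : forall X, Hom X X;
  tens : Ob -> Ob -> Ob;
  tensm : forall X X' Y Y', Hom X X' -> Hom Y Y' -> Hom (tens X Y) (tens X' Y');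
  one : Ob;
  assoc : forall X Y Z, Hom (tens X (tens Y Z)) (tens (tens X Y) Z);
  assocV : forall X Y Z, Hom (tens (tens X Y) Z) (tens X (tens Y Z));
  lunit : forall X, Hom (tens one X) X;
  lunitV : forall X, Hom X (tens one X);
  runit : forall X, Hom (tens X one) X;
  runitV : forall X, Hom X (tens X one);
  braid : forall X Y, Hom (tens X Y) (tens Y X);
  twist : forall X, Hom X X;
  dual : Ob -> Ob;
  ev : forall X, Hom (tens (dual X) X) one;
  coev : forall X, Hom one (tens X (dual X))
}.

Declare Scope cat_scope.
Delimit Scope cat_scope with cat.
Local Open Scope cat_scope.
Notation "g '\co' f" := (compm g f) (at level 50, left associativity) : cat_scope.
Notation "X '\ox' Y" := (tens X Y) (at level 40, left associativity) : cat_scope.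
Notation "f '\om' g" := (tensm f g) (at level 40, left associativity) : cat_scope.

Section Traces.
Variables (K : comNzRingType) (C : ribbon_data K).
Implicit Types U V W X Y : C.

Definition ev' W : Hom (W \ox dual W) (one C) :=
  ev W \co braid W (dual W) \co (twist W \om idm (dual W)).

Definition tr_R V W (f : Hom (V \ox W) (V \ox W)) : Hom V V :=
  runit V \co (idm V \om ev' W) \co assocV V W (dual W) \co (f \om idm (dual W))
    \co assoc V W (dual W) \co (idm V \om coev W) \co runitV V.

Definition tr_C V (f : Hom V V) : Hom (one C) (one C) :=
  ev' V \co (f \om idm (dual V)) \co coev V.

Definition negligible_mor X Y (g : Hom X Y) : Prop :=
  forall h : Hom Y X, tr_C (g \co h) = 0.

Definition negligible V : Prop := negligible_mor (idm V).

Record ideal := Ideal {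
  in_ideal :> C -> Prop;
  ideal_tens : forall V W, in_ideal V -> in_ideal (V \ox W);
  ideal_retract : forall V W (f : Hom W V) (g : Hom V W),
    in_ideal V -> g \co f = idm W -> in_ideal W
}.

Record trace (I : ideal) := Trace {
  trace_fun :> forall V, I V -> {scalar Hom V V};
  trace_partial : forall U W (IU : I U) (f : Hom (U \ox W) (U \ox W)),
    trace_fun (ideal_tens W IU) f = trace_fun IU (tr_R f);
  trace_cyclic : forall U V (IU : I U) (IV : I V) (f : Hom V U) (g : Hom U V),
    trace_fun IV (g \co f) = trace_fun IU (f \co g)
}.

Definition nonzero_trace (I : ideal) (T : trace I) : Prop :=
  exists V (IV : I V) (f : Hom V V), T V IV f <> 0.

End Traces.

(** * Deligne's category Rep(S_t) *)

(* A structure map of the Karoubian envelope is the one of the additive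
   envelope, composed on both sides with the idempotents. *)
Definition RepS (R : comNzRingType) (t : R) : ribbon_data R :=
  @RibbonData R (kobj t) (fun X Y => khom X Y)
    (@kcomp R t) (@kid R t) (@ktens0 R t) (@ktens R t) (kunit t)
    (fun X Y Z => kproj (X := ktens0 X (ktens0 Y Z)) (Y := ktens0 (ktens0 X Y) Z)
                    (fassoc R (kbase X) (kbase Y) (kbase Z)))
    (fun X Y Z => kproj (X := ktens0 (ktens0 X Y) Z) (Y := ktens0 X (ktens0 Y Z))
                    (fassocV R (kbase X) (kbase Y) (kbase Z)))
    (fun X => kproj (X := ktens0 (kunit t) X) (Y := X) (flunit R (kbase X)))
    (fun X => kproj (X := X) (Y := ktens0 (kunit t) X) (flunitV R (kbase X)))
    (fun X => kproj (X := ktens0 X (kunit t)) (Y := X) (frunit R (kbase X)))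
    (fun X => kproj (X := X) (Y := ktens0 X (kunit t)) (frunitV R (kbase X)))
    (fun X Y => kproj (X := ktens0 X Y) (Y := ktens0 Y X) (fbraid R (kbase X) (kbase Y)))
    (@kid R t)
    (@kdual0 R t)
    (fun X => kproj (X := ktens0 (kdual0 X) X) (Y := kunit t) (fev R (kbase X)))
    (fun X => kproj (X := kunit t) (Y := ktens0 X (kdual0 X)) (fcoev R (kbase X))).

(* Main.v *)
Require Import Defs.
From HB Require Import structures.
From mathcomp Require Import all_boot all_algebra ring.

Set Implicit Arguments.
Unset Strict Implicit.
Unset Printing Implicit Defensive.

Import GRing.Theory.
Local Open Scope ring_scope.

(** The trace is the derivative at T = t of the generic trace.  Let tr_T be the
    categorical trace over F[T] with parameter T.  An idempotent e with e e = e at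
    T = t lifts, modulo (T - t)^2, to an idempotent p over F[T]; explicitly
    p = 3 a^2 - 2 a^3, where a is e with constant coefficients ([lifts_idem_lift]).
    For an endomorphism f of the image V of e put
      t_V(f) = (d/dT) tr_T (p f p) at T = t.
    Adding (T - t) h to the lift of f between the two copies of p adds tr_t (e h e) to
    this value.  If V is negligible this is zero, so t_V(f) does not depend on the lift
    of f ([dtr_sandwich]) nor on p ([dtr_lift_indep]).  Thus the product of lifts may
    serve as the lift of a product, and p tensor q as the lift of a tensor product of
    idempotents.  Cyclicity and compatibility with partial traces then follow from the
    same two properties of tr_T ([dtr_lift_cyc], [dtr_lift_ptr]).

    The trace is nonzero on the image of the idempotent e on [t+1] which projects onto
    the injective (t+1)-tuples.  Evaluated at T = m, its trace counts the injections
    from a set with t+1 elements to one with m elements, so tr_T(e) =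
    T (T - 1) ... (T - t), which vanishes to first order at t, with derivative t!
    ([dtr_injP]).  The image of e is negligible since no set with t elements admits
    such an injection ([injp_null]).

    Identities between composites of diagrams are proved by colouring.  For a finite
    set K and parameter #|K|, a morphism acts as a matrix [mat] whose rows and columns
    are indexed by colourings of the vertices with colours in K; composition becomes
    the matrix product, tensor products become Kronecker products, and the structure
    maps become permutation matrices or Kronecker deltas.  Over R[T] the evaluations
    at T = #|K| for all K together are faithful when R is a domain of characteristic
    zero ([fhom_faithful]), and specialising T gives the identities for every
    parameter in R ([transfer]).  This yields naturality of the structure maps and
    the properties of traces; in the Karoubian envelope the idempotents that decorate
    the structure maps are then absorbed by the morphism whose trace is taken
    ([kval_tr_C], [kval_tr_R]). *)

(** * Coefficients and base change *)

Section Coefficients.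
Variable R : comNzRingType.

Definition dcoef A B (f : fhom R A B) i j (p : diagram (deg i) (deg j)) : R :=
  entry f i j p.

Lemma dcoef_ext A B (f g : fhom R A B) :
  (forall i j p, @dcoef A B f i j p = dcoef g p) -> f = g.
Proof. by move=> e; apply: entryP => i j; apply/ffunP => p; exact: e. Qed.

Lemma dcoef_comp (t : R) A B C (g : fhom R B C) (f : fhom R A B) i k r :
  @dcoef A C (fcomp t g f) i k r =
  \sum_j \sum_p \sum_q t ^+ loops q p * (@dcoef B C g j k q * @dcoef A B f i j p)
                        * (r == stack q p)%:R.
Proof.
rewrite /dcoef of_entriesK sum_ffunE; apply: eq_bigr => j _.
rewrite sum_ffunE; apply: eq_bigr => p _.
rewrite sum_ffunE; apply: eq_bigr => q _.
by rewrite !ffunE.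
Qed.

Lemma dcoef_tens A A' B B' (f : fhom R A A') (g : fhom R B B')
    (i : fidx (ftens0 A B)) (j : fidx (ftens0 A' B')) r :
  @dcoef _ _ (ftens f g) i j r =
  \sum_(p : diagram (deg i.1) (deg j.1)) \sum_(q : diagram (deg i.2) (deg j.2))
    dcoef f p * dcoef g q * (r == juxtapose p q)%:R.
Proof.
rewrite /dcoef of_entriesK sum_ffunE; apply: eq_bigr => p _.
rewrite sum_ffunE; apply: eq_bigr => q _.
by rewrite !ffunE.
Qed.

Lemma dcoef_dual A B (f : fhom R A B) (j : fidx B) (i : fidx A) r :
  @dcoef _ _ (fdual f) j i r = \sum_(p : diagram (deg i) (deg j)) dcoef f p * (r == flip p)%:R.
Proof.
rewrite /dcoef of_entriesK sum_ffunE; apply: eq_bigr => p _.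
by rewrite !ffunE.
Qed.

Lemma dcoef_relabel A B s (i : fidx A) (j : fidx B) r :
  @dcoef _ _ (relabel R s) i j r = (s i == j)%:R * (r == strands (deg i) (deg j))%:R.
Proof. by rewrite /dcoef of_entriesK !ffunE. Qed.

Lemma dcoef_braid A B (i : fidx (ftens0 A B)) (j : fidx (ftens0 B A)) r :
  @dcoef _ _ (fbraid R A B) i j r =
  (j == (i.2, i.1))%:R * (r == crossing (deg i.1) (deg i.2) (deg j))%:R.
Proof. by rewrite /dcoef of_entriesK !ffunE. Qed.

Lemma dcoef_ev A (i : fidx (ftens0 A A)) (j : fidx funit) r :
  @dcoef _ _ (fev R A) i j r = (i.1 == i.2)%:R * (r == cap (deg i.1) (deg i))%:R.
Proof. by rewrite /dcoef of_entriesK !ffunE. Qed.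

Lemma dcoef_coev A (i : fidx funit) (j : fidx (ftens0 A A)) r :
  @dcoef _ _ (fcoev R A) i j r = (j.1 == j.2)%:R * (r == cup (deg j.1) (deg j))%:R.
Proof. by rewrite /dcoef of_entriesK !ffunE. Qed.

Lemma dcoef_linear A B i j p : scalar (fun f : fhom R A B => @dcoef A B f i j p).
Proof. by move=> k f g; rewrite /dcoef entry_linear !ffunE. Qed.

End Coefficients.

(** The Hom spaces have the same bases over every ring, and all structure constants are
    powers of the parameter, so a ring morphism acts on coefficients compatibly with
    all operations. *)
Section BaseChange.
Variables (R S : comNzRingType) (phi : {rmorphism R -> S}).

Definition fmap A B (f : fhom R A B) : fhom S A B :=
  of_entries (fun i j => [ffun p => phi (dcoef f p)]).

Lemma dcoef_fmap A B (f : fhom R A B) i j p : @dcoef S A B (fmap f) i j p = phi (dcoef f p).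
Proof. by rewrite /dcoef of_entriesK ffunE. Qed.

Lemma fmap_comp t A B C (g : fhom R B C) (f : fhom R A B) :
  fmap (fcomp t g f) = fcomp (phi t) (fmap g) (fmap f).
Proof.
apply: dcoef_ext => i k r; rewrite dcoef_fmap !dcoef_comp rmorph_sum; apply: eq_bigr => j _.
rewrite rmorph_sum; apply: eq_bigr => p _; rewrite rmorph_sum; apply: eq_bigr => q _.
by rewrite !rmorphM rmorphXn rmorph_nat !dcoef_fmap.
Qed.

Lemma fmap_tens A A' B B' (f : fhom R A A') (g : fhom R B B') :
  fmap (ftens f g) = ftens (fmap f) (fmap g).
Proof.
apply: dcoef_ext => i j r; rewrite dcoef_fmap !dcoef_tens rmorph_sum; apply: eq_bigr => p _.
rewrite rmorph_sum; apply: eq_bigr => q _.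
by rewrite !rmorphM rmorph_nat !dcoef_fmap.
Qed.

Lemma fmap_dual A B (f : fhom R A B) : fmap (fdual f) = fdual (fmap f).
Proof.
apply: dcoef_ext => j i r; rewrite dcoef_fmap !dcoef_dual rmorph_sum; apply: eq_bigr => p _.
by rewrite !rmorphM rmorph_nat !dcoef_fmap.
Qed.

Lemma fmap_relabel A B s : fmap (@relabel R A B s) = relabel S s.
Proof.
by apply: dcoef_ext => i j r; rewrite dcoef_fmap !dcoef_relabel rmorphM !rmorph_nat.
Qed.

Lemma fmap_id A : fmap (fid R A) = fid S A.
Proof. exact: fmap_relabel. Qed.

Lemma fmap_assoc A B C : fmap (fassoc R A B C) = fassoc S A B C.
Proof. exact: fmap_relabel. Qed.

Lemma fmap_assocV A B C : fmap (fassocV R A B C) = fassocV S A B C.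
Proof. exact: fmap_relabel. Qed.

Lemma fmap_runit A : fmap (frunit R A) = frunit S A.
Proof. exact: fmap_relabel. Qed.

Lemma fmap_runitV A : fmap (frunitV R A) = frunitV S A.
Proof. exact: fmap_relabel. Qed.

Lemma fmap_braid A B : fmap (fbraid R A B) = fbraid S A B.
Proof.
by apply: dcoef_ext => i j r; rewrite dcoef_fmap !dcoef_braid rmorphM !rmorph_nat.
Qed.

Lemma fmap_ev A : fmap (fev R A) = fev S A.
Proof. by apply: dcoef_ext => i j r; rewrite dcoef_fmap !dcoef_ev rmorphM !rmorph_nat. Qed.

Lemma fmap_coev A : fmap (fcoev R A) = fcoev S A.
Proof. by apply: dcoef_ext => i j r; rewrite dcoef_fmap !dcoef_coev rmorphM !rmorph_nat. Qed.

Lemma fmapZD k A B (f g : fhom R A B) : fmap (k *: f + g) = phi k *: fmap f + fmap g.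
Proof.
by apply: dcoef_ext => i j r; rewrite dcoef_linear !dcoef_fmap dcoef_linear rmorphD rmorphM.
Qed.

End BaseChange.

(** * The matrix of a morphism on coloured states *)

Section Matrix.
Variables (R : comNzRingType) (K : finType).

(** A summand together with a colouring of its points: the index set of a basis of the
    direct sum of the tensor powers of a free module on [K]. *)
Definition state (A : fsum) := {i : fidx A & {ffun 'I_(deg i) -> K}}.

Definition mat A B (f : fhom R A B) (x : state A) (y : state B) : R :=
  \sum_p dcoef f p * (compatible p (tagged x) (tagged y))%:R.

Lemma sum_delta (T : finType) (F : T -> R) x : \sum_y (y == x)%:R * F y = F x.
Proof.
rewrite (bigD1 x) //= eqxx mul1r big1 ?addr0 // => y /negPf ->; exact: mul0r.
Qed.

(** Over a set of #|K| colours the closed components that disappear in a stack are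
    counted by their #|K| colourings, which is what [count_stack] says. *)
Lemma mat_comp A B C (g : fhom R B C) (f : fhom R A B) x z :
  mat (fcomp #|K|%:R g f) x z = \sum_y mat f x y * mat g y z.
Proof.
case: x z => [i x] [k z]; rewrite /mat /=.
transitivity (\sum_j \sum_(p : diagram (deg i) (deg j)) \sum_(q : diagram (deg j) (deg k))
   dcoef f p * dcoef g q *
      (\sum_(m : {ffun 'I_(deg j) -> K}) (compatible p x m && compatible q m z)%:R)).
  under eq_bigr do rewrite dcoef_comp mulr_suml; rewrite exchange_big; apply: eq_bigr => j _.
  under eq_bigr do rewrite mulr_suml; rewrite exchange_big; apply: eq_bigr => p _.
  under eq_bigr do rewrite mulr_suml; rewrite exchange_big; apply: eq_bigr => q _ /=.
  rewrite -natr_sum count_stack natrM natrX.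
  rewrite (bigD1 (stack q p)) //= eqxx mulr1 big1 => [|r /negPf ->]; last first.
    by rewrite mulr0 mul0r.
  by rewrite addr0 -!mulrA [LHS]mulrC -!mulrA mulrCA; congr (_ * (_ * _)); rewrite mulrC.
rewrite (eq_bigr (fun y : state B => mat f (existT _ i x) (existT _ (tag y) (tagged y))
   * mat g (existT _ (tag y) (tagged y)) (existT _ k z))); last by case.
rewrite -(@sig_big_dep _ _ _ _ _ (fun=> true) (fun _ _ => true)
  (fun j (m : {ffun 'I_(deg j) -> K}) =>
   mat f (existT _ i x) (existT _ j m) * mat g (existT _ j m) (existT _ k z))) /=.
apply: eq_bigr => j _; rewrite /mat /=.
under [RHS]eq_bigr do rewrite mulr_suml; rewrite [RHS]exchange_big; apply: eq_bigr => p _.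
under [RHS]eq_bigr do rewrite mulr_sumr; rewrite [RHS]exchange_big; apply: eq_bigr => q _ /=.
rewrite mulr_sumr; apply: eq_bigr => m _.
by rewrite mulrACA -natrM mulnb.
Qed.

(** ** Colours of a state, read as a function on all naturals *)

(** States of summands whose numbers of points are equal but not convertible are
    compared through these functions, which live in a type without dependency. *)
Definition colour A (x : state A) (k : nat) : option K := omap (tagged x) (insub k).

Lemma colour_ord A i (x : {ffun 'I_(@deg A i) -> K}) (k : 'I_(deg i)) :
  colour (Tagged (fun i => {ffun 'I_(deg i) -> K}) x) k = Some (x k).
Proof. by rewrite /colour valK. Qed.

Lemma colour_some A (x : state A) k : colour x k = (k < deg (tag x))%N :> bool.
Proof. by rewrite /colour; case: insubP => [u -> | /negPf ->]. Qed.

Lemma state_eq A (x y : state A) : tag x = tag y -> colour x =1 colour y -> x = y.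
Proof.
case: x y => [i x] [j y] /= e; case: j / e y => y h; congr existT.
by apply/ffunP => k; have := h k; rewrite !(@colour_ord A) => -[].
Qed.

Lemma glue_colour A B (x : state A) (y : state B) u v
    (w : 'I_(deg (tag x)) + 'I_(deg (tag y)) -> option K) :
  (forall k, w (inl k) = colour x k) -> (forall k, w (inr k) = colour y k) ->
  (glue (tagged x) (tagged y) u = glue (tagged x) (tagged y) v) <-> w u = w v.
Proof.
case: x y u v w => [i x] [j y] u v w hx hy.
have e z : w z = Some (glue x y z).
  by case: z => z; rewrite ?hx ?hy (@colour_ord A, @colour_ord B).
by rewrite !e; split => [->|[]].
Qed.


(** ** States of a tensor product *)

Definition join A B (x : state A) (y : state B) : state (ftens0 A B) :=
  @Tagged (fidx (ftens0 A B)) (tag x, tag y) (fun i => {ffun 'I_(deg i) -> K})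
    [ffun k => match split k with inl k => tagged x k | inr k => tagged y k end].

Definition lproj A B (z : state (ftens0 A B)) : state A :=
  @Tagged (fidx A) (tag z).1 (fun i => {ffun 'I_(deg i) -> K})
    [ffun k => tagged z (lshift _ k)].

Definition rproj A B (z : state (ftens0 A B)) : state B :=
  @Tagged (fidx B) (tag z).2 (fun i => {ffun 'I_(deg i) -> K})
    [ffun k => tagged z (rshift _ k)].

Lemma lprojK A B (x : state A) (y : state B) : lproj (join x y) = x.
Proof.
case: x y => [i x] [j y]; congr existT; apply/ffunP => k.
by rewrite !ffunE (unsplitK (inl k)).
Qed.

Lemma rprojK A B (x : state A) (y : state B) : rproj (join x y) = y.
Proof.
case: x y => [i x] [j y]; congr existT; apply/ffunP => k.
by rewrite !ffunE (unsplitK (inr k)).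
Qed.

Lemma joinK A B (z : state (ftens0 A B)) : join (lproj z) (rproj z) = z.
Proof.
case: z => [[i j] z]; congr existT; apply/ffunP => k.
by rewrite ffunE -[in RHS](splitK k); case: split => l; rewrite ffunE.
Qed.

Lemma join_eq A B (x x' : state A) (y y' : state B) :
  (join x y == join x' y') = (x == x') && (y == y').
Proof.
apply/eqP/andP => [e | [/eqP -> /eqP ->] //].
by rewrite -(lprojK x y) -{2}(rprojK x y) e lprojK rprojK.
Qed.

Lemma sum_join A B (F : state (ftens0 A B) -> R) :
  \sum_z F z = \sum_x \sum_y F (join x y).
Proof.
rewrite pair_big (reindex (fun xy => join xy.1 xy.2)) //=.
exists (fun z => (lproj z, rproj z)) => [[x y] _|z _] /=; last exact: joinK.
by rewrite lprojK rprojK.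
Qed.

Lemma colour_join A B (x : state A) (y : state B) k :
  colour (join x y) k =
    if (k < deg (tag x))%N then colour x k else colour y (k - deg (tag x))%N.
Proof.
case: x y => [i x] [j y] /=; have [lt_k|ge_k] := ltnP k (deg i).
  have -> : k = lshift (deg j) (Ordinal lt_k) by [].
  by rewrite (@colour_ord (ftens0 A B)) ffunE (unsplitK (inl _)) /= -(@colour_ord A).
have [lt_k|ge_k'] := ltnP k (deg i + deg j).
  have lt_k' : (k - deg i < deg j)%N by rewrite ltn_subLR.
  have -> : k = rshift (deg i) (Ordinal lt_k') by rewrite /= subnKC.
  rewrite (@colour_ord (ftens0 A B)) ffunE (unsplitK (inr _)) /= addKn.
  by rewrite -[(k - _)%N]/(Ordinal lt_k' : nat) (@colour_ord B).
by rewrite /colour !insubF //= ltnNge ?ge_k' // leq_subRL ?ge_k'.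
Qed.

Lemma mat_tens A A' B B' (f : fhom R A A') (g : fhom R B B') x x' y y' :
  mat (ftens f g) (join x x') (join y y') = mat f x y * mat g x' y'.
Proof.
case: x x' y y' => [i x] [i' x'] [j y] [j' y']; rewrite /mat /=.
under eq_bigr do rewrite dcoef_tens mulr_suml; rewrite exchange_big mulr_suml.
apply: eq_bigr => p _.
under eq_bigr do rewrite mulr_suml; rewrite exchange_big mulr_sumr.
apply: eq_bigr => q _ /=.
rewrite (bigD1 (juxtapose p q)) //= eqxx mulr1 big1 => [|r /negPf ->]; last first.
  by rewrite mulr0 mul0r.
rewrite addr0 mulrACA; congr (_ * _); rewrite -natrM mulnb compatible_juxtapose.
congr ((_ && _)%:R); apply: eq_compatible => k;
  by rewrite /= ffunE (unsplitK (inl _), unsplitK (inr _)).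
Qed.

Lemma mat_dual A B (f : fhom R A B) x y : mat (fdual f) y x = mat f x y.
Proof.
case: x y => [i x] [j y]; rewrite /mat /=.
under eq_bigr do rewrite dcoef_dual mulr_suml; rewrite exchange_big.
apply: eq_bigr => p _; rewrite (bigD1 (flip p)) //= eqxx mulr1 big1.
  by rewrite addr0 compatible_flip.
by move=> r /negPf ->; rewrite mulr0 mul0r.
Qed.

(** ** Matrices of the structure maps *)

(** Covers both the identity strands and the crossings: in both, every top point is
    joined to one bottom point. *)
Lemma compatible_labelled A B (x : state A) (y : state B) f :
  (forall k, (k < deg (tag x) -> f k < deg (tag y))%N) ->
  compatible (labelled _ _ f) (tagged x) (tagged y) <->
  (forall k, (k < deg (tag x))%N -> colour x k = colour y (f k)).
Proof.
move=> hf.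
pose w (u : 'I_(deg (tag x)) + 'I_(deg (tag y))) : option K :=
  match u with inl k => colour x k | inr k => colour y k end.
have hw u v := @glue_colour _ _ x y u v w (fun=> erefl) (fun=> erefl).
split=> [/compatible_fibres h k lt_k | h].
  apply: (proj1 (hw (inl (Ordinal lt_k)) (inr (Ordinal (hf k lt_k))))).
  exact: h.
apply/compatible_fibres => u v e; apply/hw.
suff ew z : w z = colour y (match z with inl k => f k | inr k => k end) by rewrite !ew e.
by case: z => k //=; exact: h.
Qed.

Lemma mat_relabel A B (s : fidx A -> fidx B) (x : state A) (z y : state B) :
  tag z = s (tag x) -> colour z =1 colour x -> mat (relabel R s) x y = (y == z)%:R.
Proof.
move=> tz cz; rewrite /mat (bigD1 (strands _ _)) //= dcoef_relabel eqxx mulr1 big1.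
  rewrite addr0 -natrM mulnb; congr (_%:R); congr nat_of_bool.
  apply/andP/eqP => [[/eqP e h]| e]; last first.
    subst y; rewrite -tz eqxx; split=> //; apply/compatible_labelled => k.
      by rewrite -!colour_some cz.
    by rewrite cz.
  have ty : tag y = tag z by rewrite tz.
  apply: state_eq => // k; rewrite cz.
  have dxy l : (l < deg (tag x))%N = (l < deg (tag y))%N.
    by rewrite ty -!colour_some cz.
  have [lt_k|ge_k] := ltnP k (deg (tag x)).
    by rewrite (proj1 (@compatible_labelled _ _ x y id _) h) // => l; rewrite dxy.
  by rewrite /colour !insubF //; apply/negbTE; rewrite -leqNgt // leqNgt -dxy -leqNgt.
by move=> r /negPf er; rewrite dcoef_relabel er mulr0 mul0r.
Qed.

Lemma mat_id A (x y : state A) : mat (fid R A) x y = (y == x)%:R.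
Proof. exact: mat_relabel. Qed.

Lemma mat_braid A B (x : state A) (x' : state B) y :
  mat (fbraid R A B) (join x x') y = (y == join x' x)%:R.
Proof.
rewrite /mat (bigD1 (crossing _ _ _)) //= dcoef_braid eqxx mulr1 big1.
  rewrite addr0 -natrM mulnb; congr (_%:R); congr nat_of_bool.
  have shift : deg (tag y) = (deg (tag x') + deg (tag x))%N ->
      forall k, (k < deg (tag x) + deg (tag x') ->
      (if k < deg (tag x) then deg (tag x') + k else k - deg (tag x)) < deg (tag y))%N.
    move=> -> k lt_k; case: (ltnP k) => [lt_k'|ge_k]; first by rewrite ltn_add2l.
    by rewrite ltn_subLR // addnA ltn_addr.
  have colE k : (k < deg (tag x) + deg (tag x'))%N ->
     colour (join x x') k = colour (join x' x)
       (if k < deg (tag x) then deg (tag x') + k else k - deg (tag x))%N.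
    move=> lt_k; rewrite !colour_join; case: (ltnP k) => [lt_k'|ge_k].
      by rewrite ltnNge leq_addr /= addKn.
    by rewrite ltn_subLR // lt_k.
  apply/andP/eqP => [[/eqP e h]| e].
    have dy : deg (tag y) = (deg (tag x') + deg (tag x))%N by rewrite e.
    have := proj1 (@compatible_labelled _ _ (join x x') y _ (shift dy)) h.
    move=> /= {}h; apply: (@state_eq (ftens0 B A)) => // k.
    have [lt_k|ge_k] := ltnP k (deg (tag x') + deg (tag x)); last first.
      by rewrite /colour !insubF //; apply/negbTE; rewrite -leqNgt ?dy.
    have [lt_k'|ge_k'] := ltnP k (deg (tag x')).
      have lt2 : (deg (tag x) + k < deg (tag x) + deg (tag x'))%N by rewrite ltn_add2l.
      by have := h _ lt2; rewrite colE // ltnNge leq_addr /= addKn => <-.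
    have lt2 : (k - deg (tag x') < deg (tag x))%N by rewrite ltn_subLR.
    have lt3 := leq_trans lt2 (leq_addr (deg (tag x')) _).
    by have := h _ lt3; rewrite colE // lt2 subnKC // => <-.
  subst y; split=> //.
  exact: (proj2 (@compatible_labelled _ _ (join x x') (join x' x) _ (shift erefl)) colE).
by move=> r /negPf er; rewrite dcoef_braid er mulr0 mul0r.
Qed.

(** The hypothesis on tags makes the label [k %% a] of a top point its position in
    its half. *)
Lemma compatible_cap A (x x' : state A) (y : state funit) : tag x = tag x' ->
  compatible (cap (deg (tag x)) _) (tagged (join x x')) (tagged y) <-> x = x'.
Proof.
move=> e; set a := deg (tag x).
pose w (u : 'I_(a + deg (tag x')) + 'I_(deg (tag y))) : option K :=
  match u with inl k => colour (join x x') k | inr k => colour y k end.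
have hw u v := @glue_colour _ _ (join x x') y u v w (fun=> erefl) (fun=> erefl).
have da : deg (tag x') = a by rewrite -e.
split=> [/compatible_fibres h | <-{x' e w hw da}].
  apply: state_eq => // k; have [lt_k|ge_k] := ltnP k a; last first.
    by rewrite /colour !insubF //; apply/negbTE; rewrite -leqNgt ?da.
  have lt1 : (k < a + deg (tag x'))%N by rewrite ltn_addr.
  have lt2 : (a + k < a + deg (tag x'))%N by rewrite ltn_add2l da.
  have : w (inl (Ordinal lt1)) = w (inl (Ordinal lt2)).
    by apply: (proj1 (hw _ _)); apply: h; rewrite /= modnDl.
  by rewrite /w /= !colour_join lt_k ltnNge leq_addr /= addKn.
pose w (u : 'I_(a + a) + 'I_(deg (tag y))) : option K :=
  match u with inl k => colour (join x x) k | inr k => colour y k end.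
have hw u v := @glue_colour _ _ (join x x) y u v w (fun=> erefl) (fun=> erefl).
apply/compatible_fibres => u v e; apply/hw.
suff ew z : w z = colour x (match z with inl k => k %% a | inr k => k end) by rewrite !ew e.
case: z => [k|[] //] /=; rewrite colour_join -/a.
have [lt_k|ge_k] := ltnP k a; first by rewrite modn_small.
have lt_k : (k - a < a)%N by rewrite ltn_subLR.
by rewrite -{2}(subnKC ge_k) modnDl modn_small.
Qed.

Lemma mat_ev A (x x' : state A) (y : state funit) :
  mat (fev R A) (join x x') y = (x == x')%:R.
Proof.
rewrite /mat (bigD1 (cap (deg (tag x)) _)) //= dcoef_ev eqxx mulr1 big1.
  rewrite addr0 -natrM mulnb; congr (_%:R); congr nat_of_bool.
  apply/andP/eqP => [[/eqP e] /compatible_cap -> // | <-]; split=> //.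
  exact/compatible_cap.
by move=> r /negPf er; rewrite dcoef_ev er mulr0 mul0r.
Qed.

Lemma mat_coev A (x x' : state A) (y : state funit) :
  mat (fcoev R A) y (join x x') = (x == x')%:R.
Proof.
rewrite /mat (bigD1 (cup (deg (tag x)) _)) //= dcoef_coev eqxx mulr1 big1.
  rewrite addr0 -natrM mulnb; congr (_%:R); congr nat_of_bool.
  rewrite compatible_flip.
  apply/andP/eqP => [[/eqP e] /(@compatible_cap _ _ _ y) -> // | <-]; split=> //.
  exact/(@compatible_cap _ _ _ y).
by move=> r /negPf er; rewrite dcoef_coev er mulr0 mul0r.
Qed.

Lemma matZD k A B (f g : fhom R A B) x y :
  mat (k *: f + g) x y = k * mat f x y + mat g x y.
Proof.
rewrite /mat mulr_sumr -big_split; apply: eq_bigr => p _ /=.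
by rewrite dcoef_linear mulrDl mulrA.
Qed.

End Matrix.

(** * Joint faithfulness of the colour matrices *)

Section Independence.
Variables (R : comNzRingType) (a b : nat).
Implicit Types p q : diagram a b.

Let linked p := [set uv | block p uv.1 == block p uv.2].

(** Colour the blocks of [p] by distinct colours.  The diagrams compatible with this
    colouring are those finer than [p], so the system of equations is triangular for
    refinement. *)
Lemma compatible_independent (K : finType) (inj : {set 'I_a + 'I_b} -> K)
    (c : diagram a b -> R) : injective inj ->
  (forall (x : {ffun 'I_a -> K}) (y : {ffun 'I_b -> K}),
     \sum_p c p * (compatible p x y)%:R = 0) ->
  forall p, c p = 0.
Proof.
move=> injK h p; have [n] := ubnP #|linked p|; elim: n p => // n IH p lt_p.
pose x := [ffun i => inj (block p (inl i))]; pose y := [ffun j => inj (block p (inr j))].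
have gl u : glue x y u = inj (block p u) by case: u => u; rewrite /= ffunE.
have := h x y; rewrite (bigD1 p) //= big1 => [|q qp].
  have -> : compatible p x y by apply/compatibleP => u v; rewrite !gl => ->.
  by rewrite mulr1 addr0.
have [cq|_] := boolP (compatible q x y); last by rewrite mulr0.
rewrite IH ?mul0r //; apply: (leq_trans _ (_ : #|linked p| <= n)%N) => //; apply/proper_card.
rewrite properE; apply/andP; split.
  apply/subsetP => -[u v]; rewrite !inE /= => /eqP e; apply/eqP/injK.
  by rewrite -!gl; move/compatibleP: cq; apply.
apply: contra qp => /subsetP sub; apply/eqP/diagram_ext => u v; split=> e.
  by apply: injK; rewrite -!gl; move/compatibleP: cq; apply.
by have := sub (u, v); rewrite !inE /= => /(_ (introT eqP e)) /eqP.
Qed.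

End Independence.

Section Transfer.
Variables (R : idomainType) (charR : [pchar R] =i pred0).

Definition ev_at (a : R) : {rmorphism {poly R} -> R} := horner_eval a.

Lemma ev_atX a : ev_at a 'X = a.
Proof. by rewrite /ev_at /= /horner_eval hornerX. Qed.

Lemma natr_inj : injective (fun n => n%:R : R).
Proof.
move=> m n e; wlog le_mn : m n e / (m <= n)%N.
  by case: (leqP m n) => [|/ltnW] le h; [|symmetry]; apply: h.
have := subrr (n%:R : R); rewrite -{2}e -natrB // => /eqP.
rewrite (pcharf0P R).1 // subn_eq0 => le_nm.
by apply/eqP; rewrite eqn_leq le_mn.
Qed.

Lemma poly_natr_eq0 (p : {poly R}) c : (forall n, p.[(c + n)%:R] = 0) -> p = 0.
Proof.
move=> h; apply: (@roots_geq_poly_eq0 _ _ [seq (c + n)%:R | n <- iota 0 (size p)]).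
- by apply/allP => _ /mapP[n _ ->]; rewrite rootE h.
- rewrite map_inj_uniq ?iota_uniq // => m n /natr_inj; exact: addnI.
- by rewrite size_map size_iota.
Qed.

Lemma poly_natr_ext (p q : {poly R}) c :
  (forall n, (c <= n)%N -> p.[n%:R] = q.[n%:R]) -> p = q.
Proof.
move=> h; apply/eqP; rewrite -subr_eq0; apply/eqP/(@poly_natr_eq0 _ c) => n.
by rewrite !hornerE h ?leq_addr // subrr.
Qed.

(** For every large [n] there is a set of [n] colours with enough colours for
    [compatible_independent], hence each coefficient vanishes at all large integers. *)
Lemma fhom_faithful A B (f g : fhom {poly R} A B) :
  (forall (K : finType) (x : state K A) (y : state K B),
     mat (fmap (ev_at #|K|%:R) f) x y = mat (fmap (ev_at #|K|%:R) g) x y) ->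
  f = g.
Proof.
move=> h; apply: dcoef_ext => i j p; pose T : finType := ({set 'I_(deg i) + 'I_(deg j)})%type.
apply: (@poly_natr_ext _ _ #|{: T}|) => n le_n.
(* The left summand colours the blocks injectively; the right one adjusts the size. *)
pose K : finType := (T + 'I_(n - #|{: T}|))%type.
have cK : #|{: K}| = n by rewrite card_sum card_ord subnKC.
apply/eqP; rewrite -subr_eq0; apply/eqP.
apply: (@compatible_independent _ _ _ K inl (fun p => (dcoef f p).[n%:R] - (dcoef g p).[n%:R])).
  by move=> ? ? [].
move=> x y.
transitivity (mat (fmap (ev_at n%:R) f) (existT _ i x : state K A) (existT _ j y : state K B)
  - mat (fmap (ev_at n%:R) g) (existT _ i x : state K A) (existT _ j y : state K B)).
  rewrite /mat -sumrB; apply: eq_bigr => q _ /=.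
  by rewrite !dcoef_fmap mulrBl.
by rewrite -cK h subrr.
Qed.

Definition lift_const A B (f : fhom R A B) : fhom {poly R} A B := fmap polyC f.

Lemma lift_constK t A B (f : fhom R A B) : fmap (ev_at t) (lift_const f) = f.
Proof.
by apply: dcoef_ext => i j p; rewrite !dcoef_fmap /ev_at /= /horner_eval hornerC.
Qed.

Lemma transfer t A B (f g : fhom {poly R} A B) :
  (forall (K : finType) (x : state K A) (y : state K B),
     mat (fmap (ev_at #|K|%:R) f) x y = mat (fmap (ev_at #|K|%:R) g) x y) ->
  fmap (ev_at t) f = fmap (ev_at t) g.
Proof. by move=> /fhom_faithful ->. Qed.

End Transfer.

(** * Naturality and partial traces *)

(** The full and the partial closure of [f], with [h] put on the closing strands: the
    idempotent of an object of the Karoubian envelope appears there.  They are locked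
    to keep unification from unfolding them. *)
HB.lock Definition fclose (R : comNzRingType) A (t : R) (f h : fhom R A A) :
    fhom R funit funit :=
  fcomp t (fcomp t (fcomp t (fev R A) (fbraid R A A)) (ftens f h)) (fcoev R A).

HB.lock Definition pclose (R : comNzRingType) A B (t : R)
    (f : fhom R (ftens0 A B) (ftens0 A B)) (h : fhom R B B) : fhom R A A :=
  fcomp t (fcomp t (fcomp t (fcomp t (fcomp t (fcomp t
    (frunit R A) (ftens (fid R A) (fcomp t (fev R B) (fbraid R B B))))
    (fassocV R A B B)) (ftens f h)) (fassoc R A B B)) (ftens (fid R A) (fcoev R B)))
    (frunitV R A).

Section MatrixCalculus.
Variables (R : comNzRingType) (K : finType).
Let t : R := #|K|%:R.

Lemma sum_deltaV (T : finType) (F : T -> R) x : \sum_y (x == y)%:R * F y = F x.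
Proof. by under eq_bigr do rewrite eq_sym; rewrite sum_delta. Qed.

(** Composing with a map whose matrix is a Kronecker delta moves the state: [mat_pre] on
    the source side, [mat_post] on the target side. *)
Lemma mat_pre A B C (g : fhom R B C) (f : fhom R A B) (x : state K A) y z :
  (forall y', mat f x y' = (y' == y)%:R) -> mat (fcomp t g f) x z = mat g y z.
Proof. by move=> e; rewrite mat_comp; under eq_bigr do rewrite e; rewrite sum_delta. Qed.

Definition ustate : state K funit :=
  @Tagged (fidx funit) tt (fun i => {ffun 'I_(deg i) -> K})
    [ffun k : 'I_0 => False_rect K (notF (ltn_ord k))].

Lemma ustateP (u : state K funit) : u = ustate.
Proof. by case: u => [[] f]; apply: state_eq => // k; rewrite /colour !insubF. Qed.

Lemma sum_ustate (F : state K funit -> R) : \sum_u F u = F ustate.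
Proof.
rewrite (bigD1 ustate) //= big1 ?addr0 // => u.
by rewrite (ustateP u) eqxx.
Qed.

Lemma mat_assoc A B C (x : state K A) (y : state K B) (z : state K C) w :
  mat (fassoc R A B C) (join x (join y z)) w = (w == join (join x y) z)%:R.
Proof.
apply: mat_relabel => // k; rewrite !colour_join /=.
case: (ltnP k (deg (tag x))) => [lt_k|ge_k]; first by rewrite ltn_addr.
by rewrite ltn_subLR // subnDA.
Qed.

Lemma mat_assocV A B C (x : state K A) (y : state K B) (z : state K C) w :
  mat (fassocV R A B C) (join (join x y) z) w = (w == join x (join y z))%:R.
Proof.
apply: mat_relabel => // k; rewrite !colour_join /=.
case: (ltnP k (deg (tag x))) => [lt_k|ge_k]; first by rewrite ltn_addr.
by rewrite ltn_subLR // subnDA.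
Qed.

Lemma mat_runit A (x : state K A) u w :
  mat (frunit R A) (join x u) w = (w == x)%:R.
Proof.
apply: mat_relabel => // k; rewrite !colour_join (ustateP u).
by case: ltnP => // ge_k; rewrite /colour !insubF // ltnNge ge_k.
Qed.

Lemma mat_runitV A (x : state K A) w :
  mat (frunitV R A) x w = (w == join x ustate)%:R.
Proof.
apply: mat_relabel => // k; rewrite !colour_join.
by case: ltnP => // ge_k; rewrite /colour !insubF // ltnNge ge_k.
Qed.

Lemma mat_post A B C (g : fhom R B C) (f : fhom R A B) (x : state K A) y z :
  (forall y', mat g y' z = (y' == y)%:R) -> mat (fcomp t g f) x z = mat f x y.
Proof.
by move=> e; rewrite mat_comp; under eq_bigr do rewrite e mulrC; rewrite sum_delta.
Qed.

Lemma mat_braid_post A B (y : state K A) (y' : state K B) x :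
  mat (fbraid R A B) x (join y' y) = (x == join y y')%:R.
Proof. by rewrite -(joinK x) mat_braid !join_eq andbC ![_ == y]eq_sym ![_ == y']eq_sym. Qed.

Lemma mat_assoc_post A B C (x : state K A) (y : state K B) (z : state K C) w :
  mat (fassoc R A B C) w (join (join x y) z) = (w == join x (join y z))%:R.
Proof.
rewrite -(joinK w) -(joinK (rproj w)) mat_assoc !join_eq -andbA.
by rewrite ![_ == x]eq_sym ![_ == y]eq_sym ![_ == z]eq_sym.
Qed.

Lemma mat_assocV_post A B C (x : state K A) (y : state K B) (z : state K C) w :
  mat (fassocV R A B C) w (join x (join y z)) = (w == join (join x y) z)%:R.
Proof.
rewrite -(joinK w) -(joinK (lproj w)) mat_assocV !join_eq -andbA.
by rewrite ![_ == x]eq_sym ![_ == y]eq_sym ![_ == z]eq_sym.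
Qed.

Lemma mat_runit_post A (x : state K A) w :
  mat (frunit R A) w x = (w == join x ustate)%:R.
Proof. by rewrite -(joinK w) mat_runit join_eq [rproj w]ustateP eqxx andbT eq_sym. Qed.

Lemma mat_runitV_post A (x : state K A) u w :
  mat (frunitV R A) w (join x u) = (w == x)%:R.
Proof. by rewrite mat_runitV join_eq [u]ustateP eqxx andbT eq_sym. Qed.

Lemma mat_fclose A (f h : fhom R A A) (u v : state K funit) :
  mat (fclose t f h) u v = \sum_(x : state K A) \sum_(y : state K A) mat f x y * mat h x y.
Proof.
rewrite fclose.unlock mat_comp sum_join; apply: eq_bigr => x _.
under eq_bigr do rewrite mat_coev; rewrite sum_deltaV mat_comp sum_join.
apply: eq_bigr => y _; transitivity (\sum_z (y == z)%:R * (mat f x y * mat h x z)).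
  apply: eq_bigr => z _; rewrite mat_tens (mat_pre _ _ (mat_braid _ _ _)) mat_ev.
  by rewrite [RHS]mulrC eq_sym.
by rewrite sum_deltaV.
Qed.

Lemma mat_pclose A B (f : fhom R (ftens0 A B) (ftens0 A B)) (h : fhom R B B)
    (x y : state K A) :
  mat (pclose t f h) x y =
  \sum_(w : state K B) \sum_(v : state K B) mat f (join x w) (join y v) * mat h w v.
Proof.
rewrite pclose.unlock (mat_pre _ _ (mat_runitV _)) mat_comp sum_join.
under eq_bigr => x' _.
  rewrite sum_join.
  under eq_bigr do under eq_bigr do rewrite mat_tens mat_id mat_coev -mulrA.
  under eq_bigr do rewrite -mulr_sumr sum_deltaV.
  rewrite -mulr_sumr.
  over.
rewrite sum_delta; apply: eq_bigr => w _.
rewrite (mat_pre _ _ (mat_assoc _ _ _)) mat_comp sum_join sum_join.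
under eq_bigr => y' _.
  under eq_bigr => v _.
    under eq_bigr => v' _.
      rewrite mat_tens (mat_pre _ _ (mat_assocV _ _ _)) mat_comp sum_join.
      under eq_bigr => z _.
        rewrite sum_ustate mat_tens mat_id (mat_pre _ _ (mat_braid _ _ _)) mat_ev mat_runit.
        rewrite -mulrA.
        over.
      rewrite sum_delta mulrCA.
      over.
    rewrite sum_delta mulrC.
    over.
  rewrite -mulr_sumr.
  over.
by rewrite sum_deltaV.
Qed.

End MatrixCalculus.

Section Traces.
Variable R : comNzRingType.

(** The isomorphism End(1) = R.  Summing over all diagrams without vertices avoids naming
    the only one. *)
Definition unit_scalar (g : fhom R funit funit) : R := \sum_p @dcoef R funit funit g tt tt p.

Definition ftr A (t : R) (f : fhom R A A) : R := unit_scalar (fclose t f (fid R A)).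

Definition ptr A B (t : R) (f : fhom R (ftens0 A B) (ftens0 A B)) : fhom R A A :=
  pclose t f (fid R B).

Lemma mat_unit_scalar (K : finType) (g : fhom R funit funit) (u v : state K funit) :
  mat g u v = unit_scalar g.
Proof.
case: u v => [[] u] [[] v]; apply: eq_bigr => p _ /=.
suff -> : compatible p u v by rewrite mulr1.
by apply/compatibleP => -[[]|[]].
Qed.

Lemma unit_scalar_eq0 g : unit_scalar g = 0 -> g = 0.
Proof.
move=> g0; apply: dcoef_ext => -[] [] p.
transitivity (0 : R); last by rewrite /dcoef !ffunE.
rewrite -[RHS]g0 /unit_scalar (bigD1 p) //= big1 ?addr0 // => q /eqP[].
by apply: diagram_ext => -[] [].
Qed.

Lemma ftr_matrix (K : finType) A (f : fhom R A A) :
  ftr #|K|%:R f = \sum_(x : state K A) mat f x x.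
Proof.
rewrite /ftr -(mat_unit_scalar _ (ustate K) (ustate K)) mat_fclose; apply: eq_bigr => x _.
by under eq_bigr do rewrite mat_id mulrC; rewrite sum_delta.
Qed.

Lemma mat_ptr (K : finType) A B (f : fhom R (ftens0 A B) (ftens0 A B)) (x y : state K A) :
  mat (ptr #|K|%:R f) x y = \sum_(w : state K B) mat f (join x w) (join y w).
Proof.
rewrite mat_pclose; apply: eq_bigr => w _.
by under eq_bigr do rewrite mat_id mulrC; rewrite sum_delta.
Qed.

End Traces.

Section FmapTraces.
Variables (R S : comNzRingType) (phi : {rmorphism R -> S}) (t : R).

Lemma fmap_fclose A (f h : fhom R A A) :
  fmap phi (fclose t f h) = fclose (phi t) (fmap phi f) (fmap phi h).
Proof. by rewrite fclose.unlock !fmap_comp fmap_ev fmap_braid fmap_tens fmap_coev. Qed.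

Lemma fmap_pclose A B (f : fhom R (ftens0 A B) (ftens0 A B)) h :
  fmap phi (pclose t f h) = pclose (phi t) (fmap phi f) (fmap phi h).
Proof.
by rewrite pclose.unlock !(fmap_comp, fmap_tens, fmap_relabel, fmap_ev, fmap_braid, fmap_coev).
Qed.

Lemma fmap_ptr A B (f : fhom R (ftens0 A B) (ftens0 A B)) :
  fmap phi (ptr t f) = ptr (phi t) (fmap phi f).
Proof. by rewrite fmap_pclose fmap_relabel. Qed.

Lemma ftr_fmap A (f : fhom R A A) : phi (ftr t f) = ftr (phi t) (fmap phi f).
Proof.
rewrite /ftr -[fid S A](fmap_relabel phi) -fmap_fclose rmorph_sum.
by apply: eq_bigr => p _; rewrite dcoef_fmap.
Qed.

End FmapTraces.

(** Unification would unfold the many operations that are built from matrices of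
    entries, so the redexes of the rewriting rules are selected syntactically. *)
Ltac rewrite_exactly e := match type of e with ?x = _ =>
    let x := eval cbv beta delta [reverse_coercion] in x in
    pattern x; refine (eq_ind_r _ _ e); cbv beta
  end.

Ltac push_fmap := cbv beta delta [reverse_coercion]; repeat match goal with
  | |- context [fmap ?phi (@ptr ?R ?A ?B ?t ?f)] => rewrite_exactly (@fmap_ptr R _ phi t A B f)
  | |- context [fmap ?phi (@fclose ?R ?A ?t ?f ?h)] =>
      rewrite_exactly (@fmap_fclose R _ phi t A f h)
  | |- context [fmap ?phi (@pclose ?R ?A ?B ?t ?f ?h)] =>
      rewrite_exactly (@fmap_pclose R _ phi t A B f h)
  | |- context [fmap ?phi (@fcomp ?R ?t ?A ?B ?C ?g ?f)] =>
      rewrite_exactly (@fmap_comp R _ phi t A B C g f)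
  | |- context [fmap ?phi (@ftens ?R ?A ?A' ?B ?B' ?f ?g)] =>
      rewrite_exactly (@fmap_tens R _ phi A A' B B' f g)
  | |- context [fmap ?phi (@fdual ?R ?A ?B ?f)] => rewrite_exactly (@fmap_dual R _ phi A B f)
  | |- context [fmap ?phi (fid ?R ?A)] => rewrite_exactly (@fmap_id R _ phi A)
  | |- context [fmap ?phi (fassoc ?R ?A ?B ?C)] => rewrite_exactly (@fmap_assoc R _ phi A B C)
  | |- context [fmap ?phi (fassocV ?R ?A ?B ?C)] => rewrite_exactly (@fmap_assocV R _ phi A B C)
  | |- context [fmap ?phi (frunit ?R ?A)] => rewrite_exactly (@fmap_runit R _ phi A)
  | |- context [fmap ?phi (frunitV ?R ?A)] => rewrite_exactly (@fmap_runitV R _ phi A)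
  | |- context [fmap ?phi (fbraid ?R ?A ?B)] => rewrite_exactly (@fmap_braid R _ phi A B)
  | |- context [fmap (ev_at ?t) (@lift_const ?R ?A ?B ?f)] =>
      rewrite_exactly (@lift_constK R t A B f)
  end; rewrite ?ev_atX.

(** In the proofs below the identity is written over R[T] for the constant lifts of the
    given morphisms; [push_fmap] evaluates it at [t] to recover the goal, and at #|K| to
    reduce it to an identity of matrices. *)

Section Laws.
Variables (R : idomainType) (charR : [pchar R] =i pred0) (t : R).

Let transfer := @transfer R charR t.

Lemma comp_idl A B (f : fhom R A B) : fcomp t (fid R B) f = f.
Proof.
have := @transfer A B (fcomp 'X (fid _ B) (lift_const f)) (lift_const f).
push_fmap; apply=> K x y; push_fmap; rewrite mat_comp.
by under eq_bigr do rewrite mat_id mulrC; rewrite sum_deltaV.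
Qed.

Lemma comp_idr A B (f : fhom R A B) : fcomp t f (fid R A) = f.
Proof.
have := @transfer A B (fcomp 'X (lift_const f) (fid _ A)) (lift_const f).
push_fmap; apply=> K x y; push_fmap; exact/mat_pre/mat_id.
Qed.

Lemma braid_nat A A' B B' (f : fhom R A A') (g : fhom R B B') :
  fcomp t (fbraid R A' B') (ftens f g) = fcomp t (ftens g f) (fbraid R A B).
Proof.
have := @transfer _ _ (fcomp 'X (fbraid _ A' B') (ftens (lift_const f) (lift_const g)))
  (fcomp 'X (ftens (lift_const g) (lift_const f)) (fbraid _ A B)).
push_fmap; apply=> K x y; push_fmap; rewrite -(joinK x) -(joinK y).
rewrite (mat_pre _ _ (mat_braid _ _ _)) (mat_post _ _ (mat_braid_post _ _ _)).
by rewrite !mat_tens mulrC.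
Qed.

Lemma assoc_nat A A' B B' C C' (f : fhom R A A') (g : fhom R B B') (h : fhom R C C') :
  fcomp t (fassoc R A' B' C') (ftens f (ftens g h)) =
  fcomp t (ftens (ftens f g) h) (fassoc R A B C).
Proof.
have := @transfer _ _
  (fcomp 'X (fassoc _ A' B' C') (ftens (lift_const f) (ftens (lift_const g) (lift_const h))))
  (fcomp 'X (ftens (ftens (lift_const f) (lift_const g)) (lift_const h)) (fassoc _ A B C)).
push_fmap; apply=> K x y; push_fmap.
rewrite -(joinK x) -(joinK (rproj x)) -(joinK y) -(joinK (lproj y)).
rewrite (mat_pre _ _ (mat_assoc _ _ _ _)) (mat_post _ _ (mat_assoc_post _ _ _ _)).
by rewrite !mat_tens mulrA.
Qed.

Lemma assocV_nat A A' B B' C C' (f : fhom R A A') (g : fhom R B B') (h : fhom R C C') :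
  fcomp t (fassocV R A' B' C') (ftens (ftens f g) h) =
  fcomp t (ftens f (ftens g h)) (fassocV R A B C).
Proof.
have := @transfer _ _
  (fcomp 'X (fassocV _ A' B' C') (ftens (ftens (lift_const f) (lift_const g)) (lift_const h)))
  (fcomp 'X (ftens (lift_const f) (ftens (lift_const g) (lift_const h))) (fassocV _ A B C)).
push_fmap; apply=> K x y; push_fmap.
rewrite -(joinK x) -(joinK (lproj x)) -(joinK y) -(joinK (rproj y)).
rewrite (mat_pre _ _ (mat_assocV _ _ _ _)) (mat_post _ _ (mat_assocV_post _ _ _ _)).
by rewrite !mat_tens mulrA.
Qed.

Lemma runit_nat A B (f : fhom R A B) :
  fcomp t (frunit R B) (ftens f (fid R funit)) = fcomp t f (frunit R A).
Proof.
have := @transfer _ _ (fcomp 'X (frunit _ B) (ftens (lift_const f) (fid _ funit)))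
  (fcomp 'X (lift_const f) (frunit _ A)).
push_fmap; apply=> K x y; push_fmap; rewrite -(joinK x).
rewrite (mat_pre _ _ (mat_runit _ _ _)) (mat_post _ _ (mat_runit_post _ _)).
by rewrite mat_tens mat_id [rproj x]ustateP eqxx mulr1.
Qed.

Lemma runitV_nat A B (f : fhom R A B) :
  fcomp t (ftens f (fid R funit)) (frunitV R A) = fcomp t (frunitV R B) f.
Proof.
have := @transfer _ _ (fcomp 'X (ftens (lift_const f) (fid _ funit)) (frunitV _ A))
  (fcomp 'X (frunitV _ B) (lift_const f)).
push_fmap; apply=> K x y; push_fmap; rewrite -(joinK y).
rewrite (mat_pre _ _ (mat_runitV _ _)) (mat_post _ _ (mat_runitV_post _ _ _)).
by rewrite mat_tens mat_id [rproj y]ustateP eqxx mulr1.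
Qed.

(** A morphism on the closing strands, upside down there, slides around the closure. *)
Lemma fclose_dual A (f h : fhom R A A) :
  fclose t f (fdual h) = fclose t (fcomp t f h) (fid R A).
Proof.
have := @transfer _ _ (fclose 'X (lift_const f) (fdual (lift_const h)))
  (fclose 'X (fcomp 'X (lift_const f) (lift_const h)) (fid _ A)).
push_fmap; apply=> K x y; push_fmap; rewrite !mat_fclose [LHS]exchange_big.
apply: eq_bigr => v _.
under [RHS]eq_bigr do rewrite mat_id mulrC; rewrite sum_delta mat_comp.
by apply: eq_bigr => w _; rewrite mat_dual mulrC.
Qed.

Lemma pclose_dual A B (f : fhom R (ftens0 A B) (ftens0 A B)) (h : fhom R B B) :
  pclose t f (fdual h) = ptr t (fcomp t f (ftens (fid R A) h)).
Proof.
have := @transfer _ _ (pclose 'X (lift_const f) (fdual (lift_const h)))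
  (ptr 'X (fcomp 'X (lift_const f) (ftens (fid _ A) (lift_const h)))).
push_fmap; apply=> K x y; push_fmap; rewrite mat_pclose mat_ptr.
rewrite exchange_big; apply: eq_bigr => v _ /=; rewrite mat_comp sum_join.
under [RHS]eq_bigr => z _.
  under eq_bigr do rewrite mat_tens mat_id -mulrA.
  rewrite -mulr_sumr.
  over.
by rewrite sum_delta; apply: eq_bigr => w _; rewrite mat_dual mulrC.
Qed.

Lemma ptr_nat A B (f : fhom R (ftens0 A B) (ftens0 A B)) (g g' : fhom R A A) :
  ptr t (fcomp t (ftens g (fid R B)) (fcomp t f (ftens g' (fid R B)))) =
  fcomp t g (fcomp t (ptr t f) g').
Proof.
have := @transfer _ _
  (ptr 'X (fcomp 'X (ftens (lift_const g) (fid _ B))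
     (fcomp 'X (lift_const f) (ftens (lift_const g') (fid _ B)))))
  (fcomp 'X (lift_const g) (fcomp 'X (ptr 'X (lift_const f)) (lift_const g'))).
push_fmap; apply=> K x y; push_fmap.
rewrite mat_ptr mat_comp.
under [RHS]eq_bigr => z _.
  rewrite mat_comp.
  under eq_bigr do rewrite mat_ptr mulr_sumr.
  rewrite exchange_big mulr_suml.
  over.
rewrite exchange_big; apply: eq_bigr => w _ /=.
rewrite mat_comp sum_join; apply: eq_bigr => z _ /=.
under eq_bigr do rewrite mat_tens mat_id mulrC eq_sym -mulrA mulrCA.
rewrite sum_delta mulrC; congr (_ * _).
rewrite mat_comp sum_join; apply: eq_bigr => z' _ /=.
by under eq_bigr do rewrite mat_tens mat_id [X in X * _]mulrC -mulrA; rewrite sum_delta.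
Qed.

Lemma ftr_horner A (a : R) (f : fhom {poly R} A A) :
  (ftr 'X f).[a] = ftr a (fmap (ev_at a) f).
Proof. by have := ftr_fmap (ev_at a) 'X f; rewrite ev_atX. Qed.

(** Generic traces are polynomials in T, and these are determined by their values at
    natural numbers. *)
Lemma ftr_poly_ext A B (f : fhom {poly R} A A) (g : fhom {poly R} B B) :
  (forall K : finType, ftr #|K|%:R (fmap (ev_at #|K|%:R) f)
                     = ftr #|K|%:R (fmap (ev_at #|K|%:R) g)) ->
  ftr 'X f = ftr 'X g.
Proof.
move=> h; apply: (@poly_natr_ext _ charR _ _ 0) => n _.
by have := h 'I_n; rewrite card_ord !ftr_horner.
Qed.

Let ftr_transfer A B (f : fhom {poly R} A A) (g : fhom {poly R} B B) :
  (forall K : finType, ftr #|K|%:R (fmap (ev_at #|K|%:R) f)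
                     = ftr #|K|%:R (fmap (ev_at #|K|%:R) g)) ->
  ftr t (fmap (ev_at t) f) = ftr t (fmap (ev_at t) g).
Proof. by move=> /ftr_poly_ext e; rewrite -!ftr_horner e. Qed.

Lemma ftr_cyc A B (f : fhom R A B) (g : fhom R B A) :
  ftr t (fcomp t g f) = ftr t (fcomp t f g).
Proof.
have := @ftr_transfer _ _ (fcomp 'X (lift_const g) (lift_const f))
  (fcomp 'X (lift_const f) (lift_const g)).
push_fmap; apply=> K; push_fmap; rewrite !ftr_matrix.
under eq_bigr do rewrite mat_comp.
under [RHS]eq_bigr do rewrite mat_comp.
by rewrite exchange_big; apply: eq_bigr => x _; apply: eq_bigr => y _; rewrite mulrC.
Qed.

Lemma ftr_ptr A B (f : fhom R (ftens0 A B) (ftens0 A B)) : ftr t (ptr t f) = ftr t f.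
Proof.
have := @ftr_transfer _ _ (ptr 'X (lift_const f)) (lift_const f).
push_fmap; apply=> K; push_fmap; rewrite !ftr_matrix sum_join.
by under eq_bigr do rewrite mat_ptr.
Qed.

End Laws.

(** * Traces in the Karoubian envelope *)

(** The structure maps of the Karoubian envelope are composed with idempotents on both
    sides.  The next lemmas remove the redundant copies.  They are stated for an
    arbitrary associative composition: only the equations listed are used, and the
    composites stay opaque. *)

Section Absorption.
Variables (O : Type) (H : O -> O -> Type)
  (cmp : forall A B C, H B C -> H A B -> H A C).
Local Notation "g \c f" := (cmp g f) (at level 40, left associativity).
Hypothesis cmpA : forall A B C D (h : H C D) (g : H B C) (f : H A B),
  h \c (g \c f) = h \c g \c f.

Lemma absorb_ev' A A' U (iU : H U U) (v : H A' U) (b : H A A') (p : H A A) (q : H A' A') :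
  iU \c v = v -> p \c p = p -> q \c q = q -> b \c p = q \c b ->
  iU \c (v \c q) \c (q \c (b \c p)) \c p = v \c b \c p.
Proof.
move=> iv pp qq bp.
have qb : q \c (b \c p) = b \c p by rewrite bp cmpA qq.
by rewrite qb (cmpA iU) iv -(cmpA v q) qb -cmpA -(cmpA b) pp cmpA.
Qed.

(** The shape of the partial trace: [e1], [e3], [e4] are the idempotents on the
    successive intermediate objects, [s] and [s'] the associators around [m]. *)
Lemma absorb_tr A A1 A3 A4 (e : H A A) (e1 : H A1 A1) (e3 : H A3 A3) (e4 m : H A4 A4)
    (r : H A1 A) (l : H A3 A1) (s : H A4 A3) (s' : H A3 A4) (l' : H A1 A3) (r' : H A A1) :
  e1 \c e1 = e1 -> e3 \c e3 = e3 -> r \c e1 = e \c r -> e1 \c r' = r' \c e ->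
  s \c e4 = e3 \c s -> s' \c e3 = e4 \c s' -> e4 \c m = m -> m \c e4 = m ->
  e1 \c (l \c e3) = l \c e3 -> e3 \c l' \c e1 = e3 \c l' ->
  (e \c (r \c e1)) \c (l \c e3) \c (e3 \c (s \c e4)) \c m \c (e4 \c (s' \c e3))
    \c (e3 \c l') \c (e1 \c (r' \c e))
  = r \c l \c s \c m \c s' \c l' \c r'.
Proof.
move=> e11 e33 re er se es em me le el.
have ls : l \c e3 \c (s \c e4) = l \c s \c e4.
  by rewrite -(cmpA l s) se -(cmpA l e3) (cmpA e3) e33.
have -> : e \c (r \c e1) \c (l \c e3) = r \c (l \c e3).
  by rewrite (cmpA e) -re -!(cmpA r) e11 le.
have -> : e3 \c (s \c e4) = s \c e4 by rewrite se cmpA e33.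
have -> : e1 \c (r' \c e) = e1 \c r' by rewrite -er cmpA e11.
have -> : e4 \c (s' \c e3) = s' \c e3 by rewrite cmpA -es -cmpA e33.
rewrite -(cmpA r) ls -!(cmpA r); congr (_ \c _).
rewrite -!(cmpA l); congr (_ \c _); rewrite -!(cmpA s); congr (_ \c _).
rewrite em es (cmpA m) me.
have -> : m \c s' \c (e3 \c l') \c (e1 \c r') = m \c s' \c (e3 \c l') \c r'.
  by rewrite -cmpA (cmpA (e3 \c l')) el cmpA.
by rewrite (cmpA _ e3) -(cmpA m) es (cmpA m) me.
Qed.

Lemma absorb_middle A B C (v : H B C) (p m : H B B) (c : H A B) :
  p \c m = m -> m \c p = m -> v \c p \c m \c (p \c c) = v \c m \c c.
Proof. by move=> pm mp; rewrite -(cmpA v) pm cmpA -(cmpA v) mp. Qed.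

End Absorption.

Section Karoubi.
Variables (R : idomainType) (charR : [pchar R] =i pred0) (t : R).
Local Notation "g \c f" := (fcomp t g f) (at level 40, left associativity).
Let idl A B := @comp_idl R charR t A B.
Let idr A B := @comp_idr R charR t A B.

Let tens_mul A A' B B' C C' (g : fhom R B C) (f : fhom R A B) (k : fhom R A C)
    (g' : fhom R B' C') (f' : fhom R A' B') (k' : fhom R A' C') :
  g \c f = k -> g' \c f' = k' -> ftens g g' \c ftens f f' = ftens k k'.
Proof. by move=> <- <-; exact: ftens_comp. Qed.

Let dual_idem A (d : fhom R A A) : d \c d = d -> fdual d \c fdual d = fdual d.
Proof. by move=> dd; rewrite -fdual_comp dd. Qed.

Section Object.
Variable W : RepS t.
Let d := kidem W.
Let dd : d \c d = d. Proof. exact: kidemP. Qed.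
Let dd' : fdual d \c fdual d = fdual d. Proof. exact: dual_idem. Qed.

(** Only the idempotent on the source is left; it will meet the one of [coev]. *)
Lemma kval_ev' :
  kval (ev' W) = (fev R (kbase W) \c fbraid R _ _) \c ftens d (fdual d).
Proof.
apply: (@absorb_ev' _ (fhom R) (fcomp t) (@fcompA R t)).
- exact: idl.
- exact: tens_mul.
- exact: tens_mul.
- exact: braid_nat.
Qed.

Lemma kval_coev : kval (coev W) = ftens d (fdual d) \c fcoev R (kbase W).
Proof.
transitivity (ftens d (fdual d) \c (fcoev R (kbase W) \c fid R funit)); first by [].
by congr (_ \c _); exact: idr.
Qed.

Lemma kval_tr_C (f : Defs.Hom W W) : kval (tr_C f) = fclose t (kval f) (fid R _).
Proof.
transitivity (kval (ev' W) \c ftens (kval f) (fdual d) \c kval (coev W)); first by [].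
rewrite kval_ev' kval_coev.
transitivity (fclose t (kval f) (fdual d)).
  rewrite fclose.unlock; apply: (@absorb_middle _ (fhom R) (fcomp t) (@fcompA R t)).
    by apply: tens_mul => //; exact: kvall.
  by apply: tens_mul => //; exact: kvalr.
by rewrite fclose_dual //; congr (fclose _ _ _); exact: kvalr.
Qed.

End Object.

Lemma kval_tr_R (V W : RepS t) (f : Defs.Hom (tens V W) (tens V W)) :
  kval (tr_R f) = ptr t (kval f).
Proof.
pose e := kidem V; pose d := kidem W.
have ee : e \c e = e by exact: kidemP.
have dd : d \c d = d by exact: kidemP.
have dd' : fdual d \c fdual d = fdual d by exact: dual_idem.
have fl : ftens e d \c kval f = kval f by exact: (@kvall R t (ktens0 V W) (ktens0 V W) f).
have fr : kval f \c ftens e d = kval f by exact: (@kvalr R t (ktens0 V W) (ktens0 V W) f).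
pose e1 := ftens e (fid R funit); pose e3 := ftens e (ftens d (fdual d)).
pose l := ftens (fid R (kbase V)) (fev R (kbase W) \c fbraid R _ _).
pose l' := ftens (fid R (kbase V)) (fcoev R (kbase W)).
have le : l \c e3 = ftens e (kval (ev' W)).
  by apply: tens_mul; [exact: idl | rewrite kval_ev'].
have el : e3 \c l' = ftens e (kval (coev W)).
  by apply: tens_mul; [exact: idr | rewrite kval_coev].
have h := @absorb_tr _ (fhom R) (fcomp t) (@fcompA R t) _ _ _ _
  e e1 e3 (ftens (ftens e d) (fdual d))
  (ftens (kval f) (fdual d)) (frunit R (kbase V)) l
  (fassocV R _ _ _) (fassoc R _ _ _) l' (frunitV R (kbase V)).
transitivity (pclose t (kval f) (fdual d)); last first.
  rewrite pclose_dual //; congr (ptr _ _).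
  transitivity (kval f \c ftens e d \c ftens (fid R _) d); first by rewrite fr.
  rewrite -fcompA; transitivity (kval f \c ftens e d); last exact: fr.
  by congr (_ \c _); apply: tens_mul => //; exact: idr.
rewrite pclose.unlock; apply: etrans (h _ _ _ _ _ _ _ _ _ _); last 10 first.
- by apply: tens_mul => //; exact: idl.
- by do 2?apply: tens_mul.
- exact: runit_nat.
- exact: runitV_nat.
- exact: assocV_nat.
- exact: assoc_nat.
- exact: tens_mul.
- exact: tens_mul.
- by rewrite le; apply: tens_mul => //; exact: idl.
- by rewrite el; apply: tens_mul => //; exact: idr.
by rewrite le el.
Qed.

End Karoubi.

(** * Differentiating the generic trace *)

Lemma linear_scale (R : pzRingType) (U V : lmodType R) (phi : U -> V) :
  linear phi -> forall k x, phi (k *: x) = k *: phi x.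
Proof.
move=> lin k x; have lin0 : phi 0 = 0.
  by have := lin (-1) 0 0; rewrite scaler0 addr0 scaleN1r addNr.
by have := lin k x 0; rewrite lin0 !addr0.
Qed.

Section Bilinearity.
Variables (R : comNzRingType) (t : R).

Lemma dcoefD A B (f g : fhom R A B) i j p : @dcoef R A B (f + g) i j p = dcoef f p + dcoef g p.
Proof. by have := @dcoef_linear R A B i j p 1 f g; rewrite scale1r mul1r. Qed.

Lemma dcoef0 A B i j p : @dcoef R A B 0 i j p = 0.
Proof. by apply: (addrI (dcoef 0 p)); rewrite -dcoefD !addr0. Qed.

Lemma dcoefZ k A B (f : fhom R A B) i j p : @dcoef R A B (k *: f) i j p = k * dcoef f p.
Proof. by have := @dcoef_linear R A B i j p k f 0; rewrite dcoef0 !addr0. Qed.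

Lemma dcoefN A B (f : fhom R A B) i j p : @dcoef R A B (- f) i j p = - dcoef f p.
Proof. by rewrite -scaleN1r dcoefZ mulN1r. Qed.

Lemma ftens_linear_l A A' B B' (g : fhom R B B') :
  linear (fun f : fhom R A A' => ftens f g).
Proof.
move=> k f f'; apply: dcoef_ext => i j r; rewrite dcoef_linear !dcoef_tens mulr_sumr -big_split.
apply: eq_bigr => p _ /=; rewrite mulr_sumr -big_split; apply: eq_bigr => q _ /=.
by rewrite dcoef_linear !mulrDl !mulrA.
Qed.

Lemma ftens_linear_r A A' B B' (f : fhom R A A') :
  linear (fun g : fhom R B B' => ftens f g).
Proof.
move=> k g g'; apply: dcoef_ext => i j r; rewrite dcoef_linear !dcoef_tens mulr_sumr -big_split.
apply: eq_bigr => p _ /=; rewrite mulr_sumr -big_split; apply: eq_bigr => q _ /=.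
by rewrite dcoef_linear mulrDr mulrDl !mulrA; congr (_ * _ * _ + _); rewrite mulrC.
Qed.

Lemma ftr_linear A : scalar (fun f : fhom R A A => ftr t f).
Proof.
move=> k f g; rewrite /ftr fclose.unlock ftens_linear_l fcomp_linear_r fcomp_linear_l.
rewrite /unit_scalar mulr_sumr -big_split; apply: eq_bigr => p _; exact: dcoef_linear.
Qed.

Lemma ftr0 A : ftr t (0 : fhom R A A) = 0.
Proof. by have := @ftr_linear A (-1) 0 0; rewrite scaler0 addr0 mulN1r addNr. Qed.

End Bilinearity.

Section Derivative.
Variables (F : fieldType) (charF : [pchar F] =i pred0) (t : F).
Local Notation P := {poly F}.
Local Notation "g \c f" := (fcomp ('X : P) g f) (at level 40, left associativity).
Local Notation ev := (fmap (ev_at t)).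
Let eps : P := 'X - t%:P.

Let charP : [pchar P] =i pred0.
Proof. by move=> p; rewrite pchar_poly charF. Qed.

(** A functional that is cyclic and linear over F, but not over F[T]: see [dtr_eps]. *)
Definition dtr A (f : fhom P A A) : F := (ftr 'X f)^`().[t].

Lemma dtr_linear A (k : F) (f g : fhom P A A) : dtr (k%:P *: f + g) = k * dtr f + dtr g.
Proof. by rewrite /dtr ftr_linear mul_polyC derivD derivZ !hornerE. Qed.

Lemma dtr_cyc A B (f : fhom P A B) (g : fhom P B A) : dtr (g \c f) = dtr (f \c g).
Proof. by rewrite /dtr ftr_cyc. Qed.

(** The Leibniz rule: a multiple of T - t contributes its value at T = t. *)
Lemma dtr_eps A (f g : fhom P A A) : dtr (eps *: f + g) = ftr t (ev f) + dtr g.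
Proof.
rewrite /dtr ftr_linear derivD derivM derivB derivX derivC !hornerE.
by rewrite ftr_horner subrr mul0r addr0 subr0 mul1r.
Qed.

Lemma ev_eps A B (f g : fhom P A B) : ev (eps *: f + g) = ev g.
Proof.
rewrite fmapZD; apply: dcoef_ext => i j p; rewrite dcoefD dcoefZ dcoef_fmap.
by rewrite /ev_at /= /horner_eval !hornerE subrr mul0r add0r.
Qed.

Lemma dtr_eps2 A (f g : fhom P A A) : dtr (eps *: (eps *: f) + g) = dtr g.
Proof.
rewrite dtr_eps -[eps *: f]addr0 ev_eps.
have -> : ev 0 = 0 :> fhom F A A.
  by apply: dcoef_ext => i j p; rewrite dcoef_fmap !dcoef0 rmorph0.
by rewrite ftr0 add0r.
Qed.

Lemma ev_eqP A B (f g : fhom P A B) : ev f = ev g -> exists h, f = eps *: h + g.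
Proof.
move=> e; exists (of_entries (fun i j => [ffun p => (dcoef f p - dcoef g p) %/ eps])).
apply: dcoef_ext => i j p; rewrite dcoef_linear {2}/dcoef of_entriesK ffunE.
apply/eqP; rewrite mulrC divpK ?subrK //.
rewrite dvdp_XsubCl rootE !hornerE subr_eq0; apply/eqP.
by have := congr1 (fun k => dcoef k p) e; rewrite !dcoef_fmap.
Qed.


(** ** Lifting idempotents modulo the square of T - t *)

Lemma compP_linear_r A B C (g : fhom P B C) k (f f' : fhom P A B) :
  g \c (k *: f + f') = k *: (g \c f) + g \c f'.
Proof. exact: fcomp_linear_r. Qed.

Lemma compP_linear_l A B C (f : fhom P A B) k (g g' : fhom P B C) :
  (k *: g + g') \c f = k *: (g \c f) + g' \c f.
Proof. exact: (@fcomp_linear_l P 'X A B C f k g g'). Qed.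

Lemma scale_eps_inj A B (f g : fhom P A B) : eps *: f = eps *: g -> f = g.
Proof.
move=> e; apply: dcoef_ext => i j p; apply: (mulfI (negbT (polyXsubC_eq0 t))).
by rewrite -!dcoefZ e.
Qed.

(** One Newton step for the equation x^2 = x, starting from the constant lift. *)
Definition idem_lift A (e : fhom F A A) : fhom P A A :=
  let a := lift_const e in 3%:R *: (a \c a) - 2%:R *: (a \c (a \c a)).

(** Idempotents modulo the square of T - t over a given idempotent. *)
Definition lifts_idem A (e : fhom F A A) (p : fhom P A A) : Prop :=
  ev p = e /\ exists z, p \c p = eps *: (eps *: z) + p.

Section Newton.
Variables (A : fsum) (m : fhom P A A -> fhom P A A -> fhom P A A).
Local Notation "x ** y" := (m x y) (at level 40, left associativity).
Hypotheses (mA : associative m)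
  (ml : forall k x y z, (k *: x + y) ** z = k *: (x ** z) + y ** z)
  (mr : forall k x y z, z ** (k *: x + y) = k *: (z ** x) + z ** y).

Lemma newton_step a u : a ** a = eps *: u + a ->
  3%:R *: (a ** a) - 2%:R *: (a ** (a ** a)) = eps *: (u - 2%:R *: (a ** u)) + a.
Proof.
move=> eu; rewrite eu mr eu; apply: dcoef_ext => i j p.
by rewrite !(dcoefD, dcoefN, dcoefZ); ring.
Qed.

(** Write a^2 = a + eps u.  Since a commutes with a^2 and eps is not a zero divisor, a
    commutes with u; the step adds eps (u - 2 a u), which cancels the error eps u. *)
Lemma newton_idem a u : a ** a = eps *: u + a ->
  let b := eps *: (u - 2%:R *: (a ** u)) + a in
  exists z, b ** b = eps *: (eps *: z) + b.
Proof.
move=> eu; set w := _ - _ => b.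
have au : a ** u = u ** a.
  apply: scale_eps_inj; apply: (addIr (a ** a)).
  by rewrite -mr -ml -eu mA.
have wE : w = (- 2%:R) *: (a ** u) + u by rewrite scaleNr addrC.
have aw : a ** w = w ** a by rewrite wE mr ml -mA -au.
have aw' : a ** w = - (a ** u) - (2%:R * eps) *: (u ** u).
  rewrite wE mr mA eu ml; apply: dcoef_ext => i j p.
  by rewrite !(dcoefD, dcoefN, dcoefZ); ring.
(* The square of b is a^2 + 2 eps a w + eps^2 w^2, where a w = - a u - 2 eps u^2. *)
exists (w ** w - 4%:R *: (u ** u)).
rewrite /b ml !mr -aw aw' eu wE; apply: dcoef_ext => i j p.
by rewrite !(dcoefD, dcoefN, dcoefZ); ring.
Qed.

End Newton.

Lemma lifts_idem_lift A (e : fhom F A A) : fcomp t e e = e -> lifts_idem e (idem_lift e).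
Proof.
move=> ee; rewrite /lifts_idem /idem_lift; set a := lift_const e.
have ea : ev a = e by exact: lift_constK.
have [u eu] : exists u, a \c a = eps *: u + a.
  by apply: ev_eqP; rewrite fmap_comp ev_atX ea.
have mA : associative (@fcomp P 'X A A A) by move=> x y z; exact: fcompA.
have ml k x y z := @compP_linear_l A A A z k x y.
have mr k x y z := @compP_linear_r A A A z k x y.
rewrite (newton_step mr eu); split; first by rewrite ev_eps.
exact: (newton_idem mA ml mr eu).
Qed.

Lemma lifts_idem_tens A B (e : fhom F A A) (d : fhom F B B) p q :
  lifts_idem e p -> lifts_idem d q -> lifts_idem (ftens e d) (ftens p q).
Proof.
move=> [<- [y ey]] [<- [z ez]]; split; first exact: fmap_tens.
exists (ftens y (q \c q) + ftens p z).
rewrite ftens_comp ey ftens_linear_l {2}ez ftens_linear_r addrA !scalerDr.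
by rewrite !(linear_scale (ftens_linear_l _)) !(linear_scale (ftens_linear_r _)).
Qed.

Lemma dtr_idem A (e : fhom F A A) p (x : fhom P A A) :
  lifts_idem e p -> dtr (p \c (p \c x)) = dtr (p \c x).
Proof.
move=> [_ [z ez]]; rewrite fcompA ez compP_linear_l.
by rewrite (linear_scale (fcomp_linear_l 'X x)) dtr_eps2.
Qed.

Lemma dtr_corner A (e : fhom F A A) p (x : fhom P A A) :
  lifts_idem e p -> dtr (p \c (x \c p)) = dtr (p \c x).
Proof.
move=> ep; rewrite (dtr_cyc (x \c p) p) -(fcompA 'X x p p) (dtr_cyc (p \c p) x).
by rewrite -(fcompA 'X p p x) (dtr_idem x ep).
Qed.

(** The images of these idempotents are the negligible objects. *)
Definition null_idem A (e : fhom F A A) : Prop :=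
  forall h, ftr t (fcomp t e (fcomp t h e)) = 0.

(** [x] and [y] differ by a multiple of T - t, whose contribution is the trace at T = t of
    an endomorphism of the image of [e]. *)
Lemma dtr_sandwich A (e : fhom F A A) p q (x y : fhom P A A) :
  null_idem e -> ev p = e -> ev q = e -> ev x = ev y ->
  dtr (p \c (x \c q)) = dtr (p \c (y \c q)).
Proof.
move=> e0 ep eq /ev_eqP[h ->]; rewrite compP_linear_l compP_linear_r dtr_eps //.
by rewrite !fmap_comp ev_atX ep eq e0 add0r.
Qed.

(** Both sides equal the value at p x q: one q may be inserted next to x by
    [dtr_sandwich], after which one of the two copies of p is redundant, and likewise with
    p and q exchanged. *)
Lemma dtr_lift_indep A (e f : fhom F A A) p q (x : fhom P A A) :
  null_idem e -> lifts_idem e p -> lifts_idem e q ->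
  ev x = f -> fcomp t e f = f -> fcomp t f e = f ->
  dtr (p \c (x \c p)) = dtr (q \c (x \c q)).
Proof.
move=> e0 ep eq xf ef fe; have [evp _] := ep; have [evq _] := eq.
transitivity (dtr (p \c (x \c q \c p))).
  by apply: (dtr_sandwich e0) => //; rewrite fmap_comp ev_atX xf evq fe.
transitivity (dtr (p \c (x \c q))); first exact: (dtr_corner _ ep).
transitivity (dtr (q \c (p \c x))); first by rewrite (fcompA 'X p x q); exact: dtr_cyc.
transitivity (dtr (q \c (p \c x \c q))); first exact/esym/(dtr_corner _ eq).
by apply: (dtr_sandwich e0) => //; rewrite fmap_comp ev_atX xf evp ef.
Qed.

(** Lift g f by g q f and f g by f p g: both sides become the generic trace of the cyclic
    word p g q f. *)
Lemma dtr_lift_cyc A B (e : fhom F A A) (d : fhom F B B) p q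
    (f : fhom F A B) (g : fhom F B A) :
  null_idem e -> null_idem d -> lifts_idem e p -> lifts_idem d q ->
  fcomp t d f = f -> fcomp t e g = g ->
  dtr (p \c (lift_const (fcomp t g f) \c p)) = dtr (q \c (lift_const (fcomp t f g) \c q)).
Proof.
move=> e0 d0 ep dq df eg; have [evp _] := ep; have [evq _] := dq.
transitivity (dtr (p \c (lift_const g \c (q \c lift_const f) \c p))).
  by apply: (dtr_sandwich e0) => //; rewrite !fmap_comp !ev_atX !lift_constK evq df.
transitivity (dtr (p \c (lift_const g \c (q \c lift_const f)))); first exact: (dtr_corner _ ep).
transitivity (dtr (q \c (lift_const f \c (p \c lift_const g)))).
  rewrite (fcompA 'X p (lift_const g)) (fcompA 'X q (lift_const f)); exact: dtr_cyc.
transitivity (dtr (q \c (lift_const f \c (p \c lift_const g) \c q))).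
  exact/esym/(dtr_corner _ dq).
by apply: (dtr_sandwich d0) => //; rewrite !fmap_comp !ev_atX !lift_constK evp eg.
Qed.

(** Use p tensor q as the lift of the tensor product of e and d.  The generic trace is
    unchanged by the partial trace, out of which the two copies of p are pulled by
    naturality; what remains between them lifts the partial trace of f. *)
Lemma dtr_lift_ptr A B (e : fhom F A A) (d : fhom F B B) p q r
    (f : fhom F (ftens0 A B) (ftens0 A B)) :
  fcomp t e e = e -> fcomp t d d = d ->
  null_idem e -> null_idem (ftens e d) ->
  lifts_idem e p -> lifts_idem d q -> lifts_idem (ftens e d) r ->
  fcomp t (ftens e d) f = f -> fcomp t f (ftens e d) = f ->
  dtr (r \c (lift_const f \c r)) = dtr (p \c (lift_const (ptr t f) \c p)).
Proof.
move=> ee dd e0 ed0 ep dq er efl efr.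
have [evp _] := ep; have [evq _] := dq.
have epq := lifts_idem_tens ep dq.
rewrite (dtr_lift_indep ed0 er epq (lift_constK t f) efl efr).
pose q1 := ftens (fid P A) q; pose p1 := ftens p (fid P B).
have pq1 : p1 \c q1 = ftens p q.
  by apply: etrans (ftens_comp _ _ _ _ _) _; congr ftens; [exact: comp_idr | exact: comp_idl].
have qp1 : q1 \c p1 = ftens p q.
  by apply: etrans (ftens_comp _ _ _ _ _) _; congr ftens; [exact: comp_idl | exact: comp_idr].
have regroup C (a b x : fhom P C C) :
  (a \c b) \c (x \c (b \c a)) = a \c ((b \c (x \c b)) \c a) by rewrite !fcompA.
have key Y : dtr (p1 \c (Y \c p1)) = dtr (p \c (ptr 'X Y \c p)).
  rewrite -(ptr_nat charP 'X Y p p) /dtr; congr (_^`().[t]); exact/esym/ftr_ptr.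
rewrite -{1}pq1 -qp1 regroup key.
apply: (dtr_sandwich e0) => //; rewrite fmap_ptr ev_atX lift_constK; congr (ptr _ _).
rewrite !fmap_comp !ev_atX lift_constK fmap_tens fmap_id evq.
have idd : fcomp t (ftens (fid F A) d) (ftens e d) = ftens e d.
  by apply: etrans (ftens_comp _ _ _ _ _) _; rewrite dd; congr ftens; exact: comp_idl.
have ddi : fcomp t (ftens e d) (ftens (fid F A) d) = ftens e d.
  by apply: etrans (ftens_comp _ _ _ _ _) _; rewrite dd; congr ftens; exact: comp_idr.
have fd : fcomp t f (ftens (fid F A) d) = f.
  by rewrite -{1}efr -(fcompA t f) ddi.
by rewrite fd -{1}efl (fcompA t (ftens (fid F A) d)) idd.
Qed.

End Derivative.

(** * The trace on negligible objects *)

Section NegligibleTrace.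
Variables (F : fieldType) (charF : [pchar F] =i pred0) (t : F).

Lemma kval_eq0 (X Y : kobj t) (f : khom X Y) : kval f = 0 -> f = 0.
Proof. by move=> f0; exact: val_inj. Qed.

Lemma tr_C_eq0 (V : RepS t) (f : Defs.Hom V V) : tr_C f = 0 <-> ftr t (kval f) = 0.
Proof.
rewrite /ftr -(kval_tr_C charF); split=> [-> | /unit_scalar_eq0 h].
  by rewrite /unit_scalar big1 // => p _; exact: dcoef0.
exact: kval_eq0.
Qed.

Lemma negligibleP (V : RepS t) :
  negligible V <-> forall h : Defs.Hom V V, ftr t (kval h) = 0.
Proof.
have e (h : Defs.Hom V V) : kval (compm (idm V) h) = kval h by exact: kvall.
split=> h0 h; first by rewrite -e; apply/tr_C_eq0/h0.
by apply/tr_C_eq0; rewrite e.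
Qed.

Lemma negligible_null (V : RepS t) : negligible V -> null_idem t (kidem V).
Proof. by move=> /negligibleP V0 h; exact: (V0 (kproj h)). Qed.

Lemma null_negligible (V : RepS t) : null_idem t (kidem V) -> negligible V.
Proof. by move=> e0; apply/negligibleP => h; rewrite -kvalE e0. Qed.

Lemma negligible_tens (V W : RepS t) : negligible V -> negligible (tens V W).
Proof.
move=> /negligibleP V0; apply/negligibleP => h.
by rewrite -(ftr_ptr charF) -(kval_tr_R charF).
Qed.

Lemma negligible_retract (V W : RepS t) (f : Defs.Hom W V) (g : Defs.Hom V W) :
  negligible V -> compm g f = idm W -> negligible W.
Proof.
move=> /negligibleP V0 gf; apply/negligibleP => h.
have -> : kval h = fcomp t (kval g) (kval (compm f h)).
  transitivity (fcomp t (kval (compm g f)) (kval h)); last exact/esym/fcompA.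
  by rewrite gf; exact/esym/kvall.
by rewrite (ftr_cyc charF); exact: (V0 (compm (compm f h) g)).
Qed.

(** Both closure properties reduce to properties of the trace: closure under tensor products
    to the partial trace, closure under retracts to cyclicity. *)
Definition negligible_ideal : ideal (RepS t) :=
  Ideal negligible_tens negligible_retract.

Definition derivative_trace (V : RepS t) (f : Defs.Hom V V) : F :=
  let p := idem_lift (kidem V) in
  dtr t (fcomp 'X p (fcomp 'X (lift_const (kval f)) p)).

Lemma derivative_trace_scalar V : scalar (@derivative_trace V).
Proof.
move=> k f g; rewrite /derivative_trace -dtr_linear.
have -> : lift_const (kval (k *: f + g)) = k%:P *: lift_const (kval f) + lift_const (kval g).
  exact: fmapZD.
congr (dtr _ _); apply: etrans (compP_linear_r _ _ _ _).
by congr (fcomp _ _ _); exact: compP_linear_l.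
Qed.

HB.instance Definition _ V :=
  GRing.isLinear.Build F (Defs.Hom V V) F _ (@derivative_trace V) (@derivative_trace_scalar V).

Lemma lifts_kidem (V : RepS t) : lifts_idem t (kidem V) (idem_lift (kidem V)).
Proof. by apply: lifts_idem_lift; exact: kidemP. Qed.

Lemma derivative_trace_partial (U W : RepS t) (f : Defs.Hom (tens U W) (tens U W)) :
  negligible U -> derivative_trace f = derivative_trace (tr_R f).
Proof.
move=> U0; rewrite {2}/derivative_trace (kval_tr_R charF).
apply: (dtr_lift_ptr charF).
- exact: kidemP.
- exact: kidemP.
- exact: negligible_null.
- exact: (negligible_null (negligible_tens U0)).
- exact: lifts_kidem.
- exact: lifts_kidem.
- exact: (lifts_kidem (tens U W)).
- exact: (@kvall F t (ktens0 U W) (ktens0 U W) f).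
- exact: (@kvalr F t (ktens0 U W) (ktens0 U W) f).
Qed.

Lemma derivative_trace_cyclic (U V : RepS t) (f : Defs.Hom V U) (g : Defs.Hom U V) :
  negligible U -> negligible V ->
  derivative_trace (compm g f) = derivative_trace (compm f g).
Proof.
move=> /negligible_null U0 /negligible_null V0; 
exact: (dtr_lift_cyc charF V0 U0 (lifts_kidem V) (lifts_kidem U) (kvall f) (kvall g)).
Qed.

Definition negligible_trace : trace negligible_ideal :=
  @Trace _ _ negligible_ideal (fun V _ => @derivative_trace V : {scalar _})
    (fun U W IU f => derivative_trace_partial f IU)
    (fun U V IU IV f g => derivative_trace_cyclic f g IU IV).

End NegligibleTrace.

(** * The projection onto injective colourings *)

Section Sieve.
Variable n : nat.

(** The object [n]. *)
Definition single : fsum := @FSum unit (fun=> n).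

Definition colouring (K : finType) (x : state K single) : {ffun 'I_n -> K} := tagged x.

(** The identity strands, with the strands at the two given places joined. *)
Definition pinch (ij : 'I_n * 'I_n) : diagram n n :=
  fibres (fun v => let k := match v with inl k => k | inr k => k end in
    if k == ij.2 then ij.1 else k).

Lemma compatible_pinch (K : finType) ij (x y : {ffun 'I_n -> K}) :
  compatible (pinch ij) x y = (y == x) && (x ij.1 == x ij.2).
Proof.
case: ij => i j /=; apply/compatible_fibres/andP => [h | [/eqP -> /eqP e] u v].
  have yx : y = x by apply/ffunP => k; exact: (h (inr k) (inl k)).
  split; first by rewrite yx.
  by apply/eqP/(h (inl i) (inl j)) => /=; rewrite eqxx; case: eqP.
have ew w : glue x x w = x (if match w with inl k => k | inr k => k end == j then i
                          else match w with inl k => k | inr k => k end).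
  by case: w => k /=; case: eqP => // ->.
by rewrite !ew /= => ->.
Qed.

Definition pinch_mor (R : comNzRingType) ij : fhom R single single :=
  @of_entries R single single (fun _ _ => basis R (pinch ij)).

(** On coloured states: the projection onto the colourings with distinct colours at the
    two given places. *)
Definition split_mor (R : comNzRingType) ij : fhom R single single :=
  fid R single - pinch_mor R ij.

Definition sieve (R : comNzRingType) (t : R) (s : seq ('I_n * 'I_n)) : fhom R single single :=
  foldr (fun ij f => fcomp t (split_mor R ij) f)
    (fid R single) s.

Definition separates (K : finType) (s : seq ('I_n * 'I_n)) (x : state K single) : bool :=
  all (fun ij => colouring x ij.1 != colouring x ij.2) s.

Lemma mat_split (R : comNzRingType) (K : finType) ij (x y : state K single) :
  mat (split_mor R ij) x y
  = (y == x)%:R * (colouring x ij.1 != colouring x ij.2)%:R.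
Proof.
rewrite /split_mor addrC -scaleN1r matZD mat_id /mat (bigD1 (pinch ij)) //= big1.
  rewrite /dcoef of_entriesK ffunE eqxx mul1r addr0.
  case: x y => [[] x] [[] y] /=; rewrite /colouring /= compatible_pinch.
  have -> : (existT _ tt y == existT _ tt x :> state K single) = (y == x).
    by rewrite -tag_eqE /tag_eq /= tagged_asE.
  by case: (y == x); case: (x _ == x _); rewrite /= ?(mul0r, mulr0, mulr1, addNr, oppr0, add0r).
by move=> p /negPf np; rewrite /dcoef of_entriesK ffunE np mul0r.
Qed.

Lemma mat_sieve (R : comNzRingType) (K : finType) s (x y : state K single) :
  mat (sieve (#|K|%:R : R) s) x y = (y == x)%:R * (separates s x)%:R.
Proof.
elim: s y => [|ij s IH] y; first by rewrite mat_id mulr1.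
rewrite /= mat_comp; under eq_bigr do rewrite IH -mulrA.
rewrite sum_delta mat_split mulrCA; congr (_ * _).
by rewrite -natrM mulnb andbC.
Qed.

Lemma fmap_split (R S : comNzRingType) (phi : {rmorphism R -> S}) ij :
  fmap phi (split_mor R ij) = split_mor S ij.
Proof.
have pinchE : fmap phi (pinch_mor R ij) = pinch_mor S ij.
  by apply: dcoef_ext => i j p; rewrite dcoef_fmap /dcoef !of_entriesK !ffunE rmorph_nat.
transitivity (fmap phi (-1 *: pinch_mor R ij + fid R single)).
  by congr fmap; rewrite /split_mor addrC scaleN1r.
apply: etrans (fmapZD _ _ _ _) _; rewrite fmap_id pinchE rmorphN1 scaleN1r.
exact: addrC.
Qed.

Lemma fmap_sieve (R S : comNzRingType) (phi : {rmorphism R -> S}) t s :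
  fmap phi (sieve t s) = sieve (phi t) s.
Proof.
elim: s => [|ij s IH]; first exact: fmap_id.
transitivity (fcomp (phi t) (fmap phi (split_mor R ij)) (fmap phi (sieve t s))).
  exact: fmap_comp.
by rewrite fmap_split IH.
Qed.

Definition all_pairs : seq ('I_n * 'I_n) := [seq ij <- enum {: 'I_n * 'I_n} | ij.1 != ij.2].

Lemma separates_all_pairs (K : finType) (x : state K single) :
  separates all_pairs x = injectiveb (colouring x).
Proof.
apply/allP/injectiveP => [h i j e | inj [i j]].
  apply/eqP; apply: contraT => ij; have := h (i, j).
  by rewrite mem_filter ij mem_enum e eqxx => /(_ isT).
by rewrite mem_filter /= => /andP[ij _]; apply: contra ij => /eqP /inj ->.
Qed.

End Sieve.

Section Nonzero.
Variables (F : fieldType) (charF : [pchar F] =i pred0).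

Local Notation injp t n := (sieve (t : F) (all_pairs n)).
Local Notation injP n := (sieve ('X : {poly F}) (all_pairs n)).

Lemma ev_injP t n : fmap (ev_at t) (injP n) = injp t n.
Proof. by rewrite fmap_sieve ev_atX. Qed.

Lemma injP_idem n : fcomp 'X (injP n) (injP n) = injP n.
Proof.
apply: (fhom_faithful charF) => K x y.
rewrite fmap_comp ev_injP ev_atX mat_comp; under eq_bigr do rewrite mat_sieve -mulrA.
rewrite sum_delta mat_sieve mulrCA; congr (_ * _).
by rewrite -natrM mulnb andbb.
Qed.

Lemma injp_idem t n : fcomp t (injp t n) (injp t n) = injp t n.
Proof.
by have := congr1 (fun f => fmap (ev_at t) f) (injP_idem n);
  rewrite fmap_comp ev_injP ev_atX.
Qed.

(** With t colours there is no injective colouring of t+1 points, so the matrix of the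
    idempotent is zero. *)
Lemma injp_null (t : nat) : null_idem t%:R (injp t%:R t.+1).
Proof.
suff h (u : F) : u = #|'I_t|%:R -> null_idem u (injp u t.+1) by apply: h; rewrite card_ord.
move=> -> h; rewrite ftr_matrix big1 // => x _; rewrite mat_comp big1 // => y _.
rewrite mat_sieve separates_all_pairs.
case: injectiveP => [inj|_]; last by rewrite !mulr0.
by have := leq_card _ inj; rewrite !card_ord ltnn.
Qed.

(** Also when [m < n]: both sides are then zero. *)
Lemma ffact_prod m n : (m ^_ n)%:R = \prod_(i < n) (m%:R - i%:R) :> F.
Proof.
elim: n => [|n IH]; first by rewrite big_ord0.
rewrite ffactnSr natrM IH big_ord_recr /=; have [le_nm|lt_mn] := leqP n m.
  by rewrite natrB.
by rewrite -IH ffact_small // !mul0r.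
Qed.

(** At T = m the trace of the projection is its rank, the number of injective colourings
    with m colours. *)
Lemma ftr_injP n : ftr 'X (injP n) = \prod_(i < n) ('X - i%:R%:P).
Proof.
apply: (@poly_natr_ext _ charF _ _ 0) => m _.
rewrite ftr_horner ev_injP horner_prod.
under [RHS]eq_bigr do rewrite hornerXsubC.
rewrite -ffact_prod.
suff h (u : F) : u = #|'I_m|%:R -> ftr u (injp u n) = (#|'I_m| ^_ n)%:R.
  by rewrite h card_ord.
move=> ->; rewrite ftr_matrix -[in RHS](card_ord n) -card_inj_ffuns -sum1_card natr_sum.
rewrite [RHS]big_mkcond [LHS](reindex
  (fun f : {ffun 'I_n -> 'I_m} => existT _ tt f : state 'I_m (single n))) /=.
  apply: eq_bigr => f _; rewrite mat_sieve separates_all_pairs eqxx mul1r inE.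
  by rewrite /colouring /=; case: injectiveb.
by exists (@colouring n 'I_m) => // -[[] f].
Qed.

Lemma dtr_injP (t : nat) : dtr t%:R (injP t.+1) = t`!%:R.
Proof.
rewrite /dtr ftr_injP big_ord_recr /= derivM derivXsubC mulr1 hornerD hornerM.
rewrite hornerXsubC subrr mulr0 add0r.
rewrite horner_prod; under eq_bigr do rewrite hornerXsubC.
by rewrite -ffact_prod ffactnn.
Qed.

End Nonzero.

Theorem corollary5p10 (F : fieldType) (charF : [pchar F] =i pred0) (t : nat) :
  exists I : ideal (RepS (t%:R : F)),
    (forall V : RepS (t%:R : F), I V <-> negligible V) /\
    exists T : trace I, nonzero_trace T.
Proof.
exists (negligible_ideal charF t%:R); split=> //.
exists (negligible_trace charF t%:R).
pose e := sieve (t%:R : F) (all_pairs t.+1); pose E := sieve ('X : {poly F}) (all_pairs t.+1).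
have ee : fcomp t%:R e e = e by exact: injp_idem.
have e0 : null_idem t%:R e by exact: injp_null.
have evE : fmap (ev_at t%:R) E = e by exact: ev_injP.
have liftE : lifts_idem t%:R e E.
  split=> //; exists 0; rewrite !scaler0 add0r; exact: injP_idem.
pose V : RepS (t%:R : F) := KObj ee.
have V0 : negligible V by exact: null_negligible.
exists V, V0, (idm V).
have -> : negligible_trace charF t%:R V V0 (idm V) = t`!%:R.
  rewrite -(dtr_injP charF).
  transitivity (dtr t%:R (fcomp 'X E (fcomp 'X (lift_const e) E))).
    apply: (dtr_lift_indep charF e0 _ liftE (lift_constK _ _) ee ee).
    exact: lifts_idem_lift.
  transitivity (dtr t%:R (fcomp 'X E (fcomp 'X E E))).
    by apply: (dtr_sandwich e0) => //; rewrite evE lift_constK.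
  by congr (dtr _ _); rewrite !injP_idem.
by apply/eqP; rewrite (pcharf0P F).1 // -lt0n fact_gt0.
Qed.
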